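(* Let $(E_n)_{n\in\mathbb{N}}$ be a betting sequence with drift certificate $(c_n)$, and let $C_t\in\mathbb{R}$ be constants with $\sum_{n\le t}c_n\ge C_t$ $\mathbb{P}_1$-a.s. Assume there are constants $s_{\max}\in(0,\infty]$ and $v_n\in[0,\infty)$ such that $\varphi_n$ is finite on $[0,s_{\max})$ $\mathbb{P}_1$-a.s. and, $\mathbb{P}_1$-a.s. for every $n\in\mathbb{N}$ and every $s\in[0,s_{\max})$, $$\operatorname{Var}_{Q_{n,s}}(L_n)\le v_n,\qquad \frac{dQ_{n,s}}{d\mathbb{P}_1(\,\cdot\mid\mathcal{F}_{n-1})}:=\frac{e^{-s(L_n-c_n)}}{\mathbb{E}_{\mathbb{P}_1}[e^{-s(L_n-c_n)}\mid\mathcal{F}_{n-1}]},$$ where $\mathbb{P}_1(\,\cdot\mid\mathcal{F}_{n-1})$ is a regular conditional distribution of $L_n$ given $\mathcal{F}_{n-1}$ and $Q_{n,s}$ its exponential tilt, so that $\operatorname{Var}_{Q_{n,s}}(L_n)$ is an $\mathcal{F}_{n-1}$-measurable random variable. Let $V_t\ge\sum_{n\le t}v_n$ be constants. Then $\psi_n(s)=v_ns^2/2$ on $[0,s_{\max})$ is a majorant; the rate function (of the aggregate $\Psi^{(t)}(s)=V_ts^2/2$ on $[0,s_{\max})$) is $\frac{x^2}{2V_t}$ for $x\le s_{\max}V_t$ and $s_{\max}x-\frac{V_ts_{\max}^2}{2}$ beyond; the optimising tilt is $$s^{\ast}_t=\min\Big\{\frac{\Delta_t}{V_t},\ s_{\max}\Big\}\quad\text{(approached,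 not attained, in the second case)};$$ and in both cases $$\bar\gamma_t(\alpha)\le\gamma_t(\alpha)\le\exp\Big(-\frac{\Delta_t}{2}\min\Big\{\frac{\Delta_t}{V_t},\ s_{\max}\Big\}\Big).$$
   Context: Conventions: $\log$ is natural, $\log0=-\infty$; $(x)_+=\max\{x,0\}$. Setting: $(\Omega,\mathcal{F})$ is a measurable space with a filtration $(\mathcal{F}_t)_{t\in\mathbb{N}_0}$, $\mathcal{F}_0=\{\emptyset,\Omega\}$, and $\mathbb{P}_0,\mathbb{P}_1$ are probability measures with $\mathbb{P}_1|_{\mathcal{F}_t}\ll\mathbb{P}_0|_{\mathcal{F}_t}$ for all $t$. A betting sequence is a family of $\mathcal{F}_n$-measurable maps $E_n:\Omega\to[0,\infty]$ with $\mathbb{E}_{\mathbb{P}_0}[E_n\mid\mathcal{F}_{n-1}]\le1$ $\mathbb{P}_0$-a.s. Wealth: $W_0=1$, $W_t=\prod_{n\le t}E_n$; $L_n:=\log E_n$. For $\alpha\in(0,1)$ and $t\in\mathbb{N}$: $\ell:=\log\frac1\alpha$, $\tau_\alpha:=\inf\{t\in\mathbb{N}:W_t>\frac1\alpha\}$, $\gamma_t(\alpha):=\mathbb{P}_1(W_t\le\frac1\alpha)$, $\bar\gamma_t(\alpha):=\mathbb{P}_1(\tau_\alpha>t)$; $\Delta_t:=(C_t-\ell)_+$. Drift certificate: real random variables $c_n$, $\mathcal{F}_{n-1}$-measurable, with $\mathbb{E}_{\mathbb{P}_1}[L_n\mid\mathcal{F}_{n-1}]\ge c_n$ $\mathbb{P}_1$-a.s.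 Put $\varphi_n(s):=\log\mathbb{E}_{\mathbb{P}_1}[e^{-s(L_n-c_n)}\mid\mathcal{F}_{n-1}]$ for $s\ge0$. Majorant on $[0,s_{\max})$: maps $\psi_n:[0,s_{\max})\times\Omega\to[0,\infty]$ with $\psi_n(s)$ $\mathcal{F}_{n-1}$-measurable, $\psi_n(0)=0$, and $\varphi_n(s)\le\psi_n(s)$ $\mathbb{P}_1$-a.s. for all $n$, $s$. Aggregate: deterministic $C_t$, $\Psi^{(t)}$ with $\sum_{n\le t}c_n\ge C_t$ and $\sum_{n\le t}\psi_n(s)\le\Psi^{(t)}(s)$ $\mathbb{P}_1$-a.s. for all $t$ and $s\in[0,s_{\max})$. Rate function: $(\Psi^{(t)})^{\star}(x):=\sup_{s\in[0,s_{\max})}\{sx-\Psi^{(t)}(s)\}$, $x\ge0$; the optimising tilt is the point at which this supremum at $x=\Delta_t$ is attained or approached. The two cases are $\Delta_t\le s_{\max}V_t$ and $\Delta_t>s_{\max}V_t$. *)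

(* Defs.v *)
From HB Require Import structures.
From mathcomp Require Import all_boot all_order all_algebra.
From mathcomp Require Import all_classical all_reals all_analysis.
From mathcomp Require Import measurable_realfun.

Set Implicit Arguments.
Unset Strict Implicit.
Unset Printing Implicit Defensive.

Import Order.TTheory GRing.Theory Num.Theory.
Import numFieldNormedType.Exports.

Local Open Scope classical_set_scope.
Local Open Scope ring_scope.
Local Open Scope ereal_scope.

(* Sub-sigma-algebras are sets of sets [G]; [g_sigma_algebraType G] is the
   carrier type equipped with the sigma-algebra generated by [G], which is [G]
   itself when [G] is a sigma-algebra. *)
Definition measurable_wrt d d' (T : measurableType d) (U : measurableType d')
    (G : set (set T)) (f : T -> U) : Prop :=
  measurable_fun [set: g_sigma_algebraType G] (f : g_sigma_algebraType G -> U).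

Definition is_filtration d (T : measurableType d) (F : nat -> set (set T)) :
    Prop :=
  [/\ forall t, sigma_algebra setT (F t),
      forall t, F t `<=` measurable,
      forall s t, (s <= t)%N -> F s `<=` F t
    & F 0%N = [set set0; setT]].

Definition dominated_on d (T : measurableType d) (R : realType)
    (G : set (set T)) (P Q : probability T R) : Prop :=
  forall A, G A -> Q A = 0 -> P A = 0.

Section conditional_expectation.
Context d (T : measurableType d) (R : realType) (P : probability T R)
  (G : set (set T)).

(* [Y] is a version of the conditional expectation of [X >= 0] given [G] *)
Definition is_cexp (X Y : T -> \bar R) : Prop :=
  [/\ measurable_wrt G Y, forall w, 0 <= Y w
    & forall A, G A -> \int[P]_(w in A) Y w = \int[P]_(w in A) X w].

Definition cexp_ge0 (X : T -> \bar R) : T -> \bar R := get (is_cexp X).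

(* The difference of two infinities is [-oo], so that a finite lower bound on
   [cexp X] forces the negative part of [X] to be conditionally integrable. *)
Definition cexp (X : T -> \bar R) : T -> \bar R :=
  fun w => cexp_ge0 X^\+ w - cexp_ge0 X^\- w.

Definition is_regular_cond_dist (X : T -> \bar R)
    (k : R.-pker (g_sigma_algebraType G) ~> \bar R) : Prop :=
  forall A B, G A -> measurable B ->
    P (A `&` X @^-1` B) = \int[P]_(w in A) k w B.

End conditional_expectation.

Section density_measure.
Context d (T : measurableType d) (R : realType)
  (mu : {measure set T -> \bar R}) (f : T -> \bar R).

Definition mdensity of (forall x, 0 <= f x) & measurable_fun [set: T] f :
  set T -> \bar R := fun A => \int[mu]_(x in A) f x.

Context (f0 : forall x, 0 <= f x) (mf : measurable_fun [set: T] f).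

Let mdensity0 : mdensity f0 mf set0 = 0.
Proof. by rewrite /mdensity integral_set0. Qed.

Let mdensity_ge0 A : 0 <= mdensity f0 mf A.
Proof. exact: integral_ge0. Qed.

Let mdensity_sigma_additive : semi_sigma_additive (mdensity f0 mf).
Proof.
move=> A mA tA mUA; rewrite /mdensity ge0_integral_bigcup//.
- by apply: is_cvg_ereal_nneg_natsum_cond => n _ _; exact: integral_ge0.
- exact: measurable_funTS.
Qed.

HB.instance Definition _ := isMeasure.Build _ _ _ (mdensity f0 mf)
  mdensity0 mdensity_ge0 mdensity_sigma_additive.

End density_measure.

Lemma measurable_expeR (R : realType) :
  measurable_fun [set: \bar R] (@expeR R).
Proof.
rewrite [X in measurable_fun _ X](_ : _ =
    fun x : \bar R => if x == -oo then 0 else er_map expR x); last first.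
  by apply/funext => -[].
apply: measurable_fun_ifT => //.
  exact: measurable_fun_eqe.
by apply: (@measurable_er_map _ (\bar R)); exact: measurable_expR.
Qed.

(* In this section [k] plays the part of the conditional law of [L_n] and [c]
   that of the value of [c_n].  The normaliser is computed from [k]: it is the
   version of the conditional expectation of exp(-s(L_n-c_n)) given by the
   regular conditional distribution, hence is defined for all [s] at once. *)
Section exponential_tilt.
Context (R : realType) (k : {measure set (\bar R) -> \bar R}) (c s : R).

Definition tilt_weight (x : \bar R) : \bar R := expeR (- (s%:E * (x - c%:E))).

Definition tilt_norm : \bar R := \int[k]_x tilt_weight x.

Definition tilt_density (x : \bar R) : \bar R := tilt_weight x / tilt_norm.

Lemma tilt_density_ge0 x : 0 <= tilt_density x.
Proof.
rewrite mule_ge0 ?expeR_ge0// inve_ge0.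
by apply: integral_ge0 => y _; exact: expeR_ge0.
Qed.

Lemma measurable_tilt_density : measurable_fun setT tilt_density.
Proof.
rewrite /tilt_density.
under eq_fun do rewrite muleC.
apply: measurable_funeM.
apply: (measurableT_comp (@measurable_expeR R)).
apply: measurableT_comp => //.
apply: measurable_funeM.
exact: emeasurable_funB.
Qed.

Definition tilt : {measure set (\bar R) -> \bar R} :=
  mdensity k tilt_density_ge0 measurable_tilt_density.

End exponential_tilt.

(* Mean and variance of the identity map under a law on [\bar R]; the variance
   is [+oo] unless the law has a finite second moment. *)
Definition law_mean (R : realType) (Q : {measure set (\bar R) -> \bar R}) :
  \bar R := \int[Q]_x x.

Definition law_variance (R : realType) (Q : {measure set (\bar R) -> \bar R}) :
  \bar R := \int[Q]_x (x - law_mean Q) ^+ 2.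

Section betting.
Context d (T : measurableType d) (R : realType).
Implicit Types (P : probability T R) (F : nat -> set (set T))
  (E : nat -> T -> \bar R) (c : nat -> T -> R) (smax : \bar R).

(* Processes are indexed from 1; the values at index 0 are never used. *)
Definition betting_sequence P F E : Prop :=
  forall n, (0 < n)%N ->
    [/\ measurable_wrt (F n) (E n), forall w, 0 <= E n w
      & {ae P, forall w, cexp P (F n.-1) (E n) w <= 1}].

Definition wealth E (t : nat) (w : T) : \bar R :=
  \prod_(1 <= n < t.+1) E n w.

Definition log_increment E (n : nat) (w : T) : \bar R := lne (E n w).

Definition crossing_time E (alpha : R) (w : T) : \bar R :=
  ereal_inf [set (n%:R)%:E | n in
    [set n | (0 < n)%N /\ (alpha^-1)%:E < wealth E n w]].

Definition miss_prob P E (alpha : R) (t : nat) : \bar R :=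
  P [set w | wealth E t w <= (alpha^-1)%:E].

Definition seq_miss_prob P E (alpha : R) (t : nat) : \bar R :=
  P [set w | (t%:R)%:E < crossing_time E alpha w].

Definition drift_certificate P F E c : Prop :=
  forall n, (0 < n)%N ->
    measurable_wrt (F n.-1) (c n) /\
    {ae P, forall w, (c n w)%:E <= cexp P (F n.-1) (log_increment E n) w}.

Definition cond_log_mgf P F E c (n : nat) (s : R) : T -> \bar R :=
  fun w => lne (cexp P (F n.-1)
    (fun w' => expeR (- (s%:E * (log_increment E n w' - (c n w')%:E)))) w).

Definition tilt_domain smax : set R := [set s | (0 <= s)%R /\ s%:E < smax].

Definition is_majorant P F E c smax (psi : nat -> R -> T -> \bar R) : Prop :=
  forall n, (0 < n)%N ->
    (forall w, psi n 0%R w = 0) /\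
    forall s, tilt_domain smax s ->
      [/\ measurable_wrt (F n.-1) (psi n s), forall w, 0 <= psi n s w
        & {ae P, forall w, cond_log_mgf P F E c n s w <= psi n s w}].

Definition is_aggregate P c smax (psi : nat -> R -> T -> \bar R)
    (C : nat -> R) (Psi : nat -> R -> \bar R) : Prop :=
  forall t, (0 < t)%N ->
    {ae P, forall w, (C t <= \sum_(1 <= n < t.+1) c n w)%R} /\
    forall s, tilt_domain smax s ->
      {ae P, forall w, \sum_(1 <= n < t.+1) psi n s w <= Psi t s}.

End betting.

Section rate_function.
Context (R : realType) (smax : \bar R) (Psi : R -> \bar R).

Definition rate_objective (x s : R) : \bar R := (s * x)%:E - Psi s.

Definition rate_function (x : R) : \bar R :=
  ereal_sup [set rate_objective x s | s in tilt_domain smax].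

Definition sup_attained_at (x : R) (s : \bar R) : Prop :=
  exists r : R, [/\ s = r%:E, tilt_domain smax r
    & rate_objective x r = rate_function x].

Definition sup_approached_at (x : R) (s : \bar R) : Prop :=
  exists u : R^nat, [/\ forall k, tilt_domain smax (u k),
    (u k)%:E @[k --> \oo] --> s
    & rate_objective x (u k) @[k --> \oo] --> rate_function x].

End rate_function.

Definition excess_drift (R : realType) (C alpha : R) : R :=
  Num.max (C - ln alpha^-1)%R 0%R.

(* [Delta / V] is the quotient of [\bar R]: for [V = 0] it is [+oo] if
   [0 < Delta], and [0] if [Delta = 0]. *)
Definition optimal_tilt (R : realType) (smax : \bar R) (V Delta : R) : \bar R :=
  mine (Delta%:E / V%:E) smax.

(* Main.v *)
(** Conditionally on the past, write [Y = L_n - c_n] and [M(s) = E e^(-sY)].  On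
    ]0, smax[ the second derivative of [ln M] at [s] is the variance of [Y] under
    the tilted law, so [f(s) = ln M(s) - v s^2/2] is concave there.  To the
    left of 0, [M] may be infinite, so 0 is treated separately: near 0 the mean
    [m = E Y >= 0] gives [-O(h) <= f(h)] (Jensen) and
    [f(h) <= O(h^2)] (from [e^z <= 1 + z + z^2 (1 + e^z)]).  Feeding both bounds
    into the chord inequality through [h^2 < h < s] and letting [h -> 0] gives
    [f(s) <= 0], which is the sub-Gaussian majorant.

    The product of the weights [e^(-s(L_n - c_n))] then has expectation at most
    [e^(V s^2/2)], and on the event [W_t <= 1/alpha] it is at least
    [e^(s Delta)]; Markov's inequality and optimisation over [s] conclude.

    All conditional expectations are computed from the regular conditional
    distributions [kappa n], and the a.e. finiteness of [L_n] under [P1] comes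
    from the variance bound at [s = 0]. *)

Require Import Defs.
From mathcomp Require Import all_boot all_order all_algebra.
From mathcomp Require Import all_classical all_reals all_analysis.
From mathcomp Require Import measurable_realfun.
From mathcomp Require Import ring lra.

Import Order.TTheory GRing.Theory Num.Theory.
Import numFieldNormedType.Exports.

Local Open Scope classical_set_scope.
Local Open Scope ring_scope.
Local Open Scope ereal_scope.

Set Implicit Arguments.
Unset Strict Implicit.
Unset Printing Implicit Defensive.

(** * Sub-Gaussian bound from the variance of the tilted laws *)

Local Close Scope ereal_scope.

(** * Elementary inequalities for the exponential *)

Section exp_bounds.
Context (R : realType).
Implicit Types (e z : R).

(** Raise [1 + t <= expR t] to the power [k] at [t = e * |z| / k]. A power of [z] thus costs only an
    arbitrarily small change of the exponent. *)
Lemma normrX_le_expR (k : nat) e z : 0 < e ->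
  `|z| ^+ k <= (k%:R / e) ^+ k * expR (e * `|z|).
Proof.
move=> e0; case: k => [|k].
  by rewrite !expr0 mul1r -expR0 ler_expR mulr_ge0// ltW.
have k0 : 0 < k.+1%:R :> R by [].
pose t := e * `|z| / k.+1%:R.
have -> : e * `|z| = t * k.+1%:R by rewrite /t divfK.
rewrite expRM_natr -exprMn lerXn2r ?nnegrE//.
  by rewrite mulr_ge0 ?expR_ge0// divr_ge0// ltW.
have -> : `|z| = k.+1%:R / e * t.
  by rewrite /t; field; rewrite nat1r gt_eqF//= gt_eqF.
apply: ler_wpM2l; first by rewrite divr_ge0// ltW.
by apply: le_trans (expR_ge1Dx t); rewrite lerDr.
Qed.

(** From [1 - z <= expR (- z)] follows [expR z - 1 - z <= z * (expR z - 1)]. The right side is at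
    most [z ^+ 2 * expR z] if [0 <= z], and at most [z ^+ 2] if [z < 0]. *)
Lemma expR_le_quadratic z : expR z <= 1 + z + z ^+ 2 * (1 + expR z).
Proof.
have h1 := expR_ge1Dx z.
have h2 := expR_ge1Dx (- z).
have e0 := expR_gt0 z.
have h3 : expR z * expR (- z) = 1 by rewrite -expRD subrr expR0.
have h4 : expR z - 1 <= z * expR z by nra.
have [z0|z0] := leP 0 z; nra.
Qed.

(** The left side is monotone in [s], so one endpoint dominates; the sign of [z] decides which, and
    the sum covers both signs. *)
Lemma expRN_le_add (a b s z : R) : a <= s <= b ->
  expR (- (s * z)) <= expR (- (a * z)) + expR (- (b * z)).
Proof.
move=> /andP[as_ sb]; have [z0|z0] := leP 0 z.
  rewrite ler_wpDr ?expR_ge0// ler_expR lerN2; exact: ler_wpM2r.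
rewrite ler_wpDl ?expR_ge0// ler_expR lerN2; apply: ler_wnM2r => //.
exact: ltW.
Qed.

(** The bound is uniform in [s] over [[a, b]], as domination requires: the power is absorbed by
    moving each endpoint outwards by [e]. *)
Lemma normX_expR_le (k : nat) (a b e s z : R) : 0 < e -> a <= s <= b ->
  `|z ^+ k * expR (- (s * z))| <= (k%:R / e) ^+ k *
    (expR (- ((a - e) * z)) + expR (- ((b + e) * z))).
Proof.
move=> e0 asb; rewrite normrM normrX (ger0_norm (expR_ge0 _)).
apply: le_trans (ler_wpM2r (expR_ge0 _) (normrX_le_expR k z e0)) _.
rewrite -mulrA; apply: ler_wpM2l.
  by rewrite exprn_ge0// divr_ge0// ltW.
rewrite -expRD; have /andP[as_ sb] := asb.
have [z0|z0] := leP 0 z.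
  rewrite ler_wpDr ?expR_ge0// ler_expR ger0_norm//; nra.
rewrite ler_wpDl ?expR_ge0// ler_expR ltr0_norm//; nra.
Qed.

End exp_bounds.

(** Two steps of length [e] fit on each side of [s]: one for the neighbourhood in which the tilt
    varies, one for absorbing powers of [Y]. The left end may be 0, which belongs to the domain. *)
Lemma tilt_domain_room (R : realType) (smax : \bar R) (s : R) :
  0 < s -> (s%:E < smax)%E ->
  exists2 e, 0 < e & 0 <= s - e - e /\ ((s + e + e)%:E < smax)%E.
Proof.
case: smax => [m| |] s0 //.
- rewrite lte_fin => sm; exists (Num.min s (m - s) / 4).
    by rewrite divr_gt0// lt_min s0 subr_gt0.
  have h1 : Num.min s (m - s) <= s by rewrite ge_min lexx.
  have h2 : Num.min s (m - s) <= m - s by rewrite ge_min lexx orbT.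
  by split; rewrite ?lte_fin; lra.
- by move=> _; exists (s / 2); rewrite ?ltry; lra.
Qed.

Lemma is_derive_expRN (R : realType) (k : nat) (z s : R) :
  is_derive s 1 (fun t => z ^+ k * expR (- (t * z)))
    (- (z ^+ k.+1 * expR (- (s * z)))).
Proof.
have D : is_derive s 1 ((- z) \*: id : R -> R) (- z).
  by apply: is_derive_eq; rewrite scaler1.
have -> : (fun t => z ^+ k * expR (- (t * z))) =
    (z ^+ k) \*: (expR \o ((- z) \*: id : R -> R)).
  by apply/funext => t; rewrite /= /GRing.scale/= mulNr [z * t]mulrC.
apply: is_derive_eq; rewrite /= /GRing.scale/= mulNr [z * s]mulrC.
by rewrite exprS; ring.
Qed.

(** * Differentiation of tilted moments under the integral sign *)

Section tilted_moments.
Context (d : measure_display) (T : measurableType d) (R : realType)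
  (mu : {measure set T -> \bar R}) (Y : T -> R) (smax : \bar R).
Hypothesis mY : measurable_fun [set: T] Y.
Hypothesis Yfin : forall s, tilt_domain smax s ->
  (\int[mu]_x (expR (- (s * Y x)))%:E < +oo)%E.

(** For [s] inside the domain this is, up to the sign [(-1)^k], the [k]-th derivative of the Laplace
    transform of [Y]. *)
Definition tilted_moment (k : nat) (s : R) : R :=
  \int[mu]_x (Y x ^+ k * expR (- (s * Y x))).

Lemma measurable_tilted (k : nat) (s : R) :
  measurable_fun [set: T] (fun x => Y x ^+ k * expR (- (s * Y x))).
Proof.
apply: measurable_funM; first exact: measurable_funX.
apply: measurableT_comp => //; apply: measurableT_comp => //.
exact: measurable_funM.
Qed.

Lemma integrable_expRN (s : R) : tilt_domain smax s ->
  mu.-integrable [set: T] (EFin \o (fun x => expR (- (s * Y x)))).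
Proof.
move=> sD; apply/integrableP; split.
  apply/measurable_EFinP; have := measurable_tilted 0 s.
  by under eq_fun do rewrite expr0 mul1r.
by under eq_integral do rewrite gee0_abs ?lee_fin ?expR_ge0//; exact: Yfin.
Qed.

Lemma tilted_dominated (k : nat) (s : R) : 0 < s -> (s%:E < smax)%E ->
  exists e (G : T -> R), [/\ 0 < e, (forall x, 0 <= G x),
    mu.-integrable [set: T] (EFin \o G),
    (0 <= s - e) /\ ((s + e)%:E < smax)%E & forall (t : R) x, t \in `]s - e, s + e[ ->
      `|Y x ^+ k * expR (- (t * Y x))| <= G x].
Proof.
move=> s0 sm; have [e e0 [se1 se2]] := tilt_domain_room s0 sm.
exists e, (fun x => (k%:R / e) ^+ k *
  (expR (- ((s - e - e) * Y x)) + expR (- ((s + e + e) * Y x)))); split => //.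
- move=> x; rewrite mulr_ge0 ?addr_ge0 ?expR_ge0// exprn_ge0// divr_ge0//.
  exact: ltW.
- rewrite /comp; under eq_fun do rewrite EFinM EFinD.
  apply: integrableZl => //; apply: integrableD => //.
    apply: integrable_expRN; split => //; apply: lt_trans sm.
    by rewrite lte_fin; lra.
  by apply: integrable_expRN; split => //; lra.
- split; first lra.
  by apply: lt_trans se2; rewrite lte_fin; lra.
- move=> t x; rewrite in_itv/= => /andP[t1 t2]; apply: normX_expR_le => //.
  by rewrite !ltW.
Qed.

Lemma integrable_tilted (k : nat) (s : R) : 0 < s -> (s%:E < smax)%E ->
  mu.-integrable [set: T] (EFin \o (fun x => Y x ^+ k * expR (- (s * Y x)))).
Proof.
move=> s0 sm; have [e [G [e0 G0 iG _ leG]]] := tilted_dominated k s0 sm.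
apply: (le_integrable _ _ _ iG) => //.
  exact/measurable_EFinP/measurable_tilted.
move=> x _; rewrite /= lee_fin (ger0_norm (G0 x)); apply: leG.
by rewrite in_itv/=; lra.
Qed.

(** Differentiating in [s] brings down a factor [- Y], so the dominating function is the one that
    [tilted_dominated] gives for the power [k.+1]. *)
Lemma is_derive_tilted_moment (k : nat) (s : R) : 0 < s -> (s%:E < smax)%E ->
  is_derive s 1 (tilted_moment k) (- tilted_moment k.+1 s).
Proof.
move=> s0 sm; have [e [G [e0 G0 iG [se1 se2] leG]]] := tilted_dominated k.+1 s0 sm.
have sI : `]s - e, s + e[%classic s by rewrite /= in_itv/=; lra.
pose f t x := Y x ^+ k * expR (- (t * Y x)).
have intf (t : R) : `]s - e, s + e[%classic t -> mu.-integrable [set: T] (EFin \o f t).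
  rewrite /= in_itv/= => /andP[t1 t2]; apply: integrable_tilted; first lra.
  by apply: lt_trans se2; rewrite lte_fin.
have df (t : R) (x : T) : is_derive t 1 (f ^~ x) (- (Y x ^+ k.+1 * expR (- (t * Y x)))).
  exact: is_derive_expRN.
have derf (t : R) (x : T) : `]s - e, s + e[%classic t -> [set: T] x ->
    derivable (f ^~ x) t 1.
  by move=> _ _; have [] := df t x.
have d1f (t : R) (x : T) : partial1of2 f t x = - (Y x ^+ k.+1 * expR (- (t * Y x))).
  by rewrite partial1of2E; have [] := df t x.
have Gub (t : R) (x : T) : `]s - e, s + e[%classic t -> [set: T] x ->
    `|partial1of2 f t x| <= G x.
  by move=> tI _; rewrite d1f normrN; exact: leG.
apply: DeriveDef.
  exact: (derivable_under_integral measurableT sI intf derf G0 iG Gub).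
rewrite -derive1E (differentiation_under_integral measurableT sI intf derf G0 iG Gub).
under eq_Rintegral do rewrite d1f -mulN1r.
by rewrite RintegralZl ?mulN1r//; exact: integrable_tilted.
Qed.

End tilted_moments.

(** * Chord inequalities for concave functions *)

Lemma MVT_is_derive (R : realType) (f df : R -> R) (a b : R) : a < b ->
  (forall x : R, x \in `[a, b] -> is_derive x 1 f (df x)) ->
  exists2 c, c \in `]a, b[%R & f b - f a = df c * (b - a).
Proof.
move=> ab fdf.
have h1 (x : R) : x \in `]a, b[ -> is_derive x 1 f (df x).
  by move=> xab; apply: fdf; exact: subset_itv_oo_cc.
have h2 : {within `[a, b], continuous f}.
  by apply: derivable_within_continuous => x xab; have [] := fdf x xab.
exact: (@MVT R f df a b ab h1 h2).
Qed.

(** The mean value theorem turns the slopes of the two chords into values of [g] at points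
    [c1 < c2]; a third application, to [g] itself, gives [g c2 <= g c1]. *)
Lemma is_derive2_le0_chord (R : realType) (f g dg : R -> R) (x y z : R) :
  x < y -> y < z ->
  (forall t : R, t \in `[x, z] -> is_derive t 1 f (g t)) ->
  (forall t : R, t \in `[x, z] -> is_derive t 1 g (dg t)) ->
  (forall t : R, t \in `[x, z] -> dg t <= 0) ->
  (f z - f y) * (y - x) <= (f y - f x) * (z - y).
Proof.
move=> xy yz fg gdg dg0.
have sub (a b t : R) : x <= a -> b <= z -> t \in `[a, b] -> t \in `[x, z].
  by rewrite !in_itv/= => xa bz /andP[at_ tb]; rewrite (le_trans xa)// (le_trans tb).
have f1 (t : R) : t \in `[x, y] -> is_derive t 1 f (g t).
  by move=> ti; apply: fg; exact: (sub x y t (lexx x) (ltW yz)).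
have f2 (t : R) : t \in `[y, z] -> is_derive t 1 f (g t).
  by move=> ti; apply: fg; exact: (sub y z t (ltW xy) (lexx z)).
have [c1 c1xy e1] := @MVT_is_derive R f g x y xy f1.
have [c2 c2yz e2] := @MVT_is_derive R f g y z yz f2.
move: c1xy c2yz; rewrite !in_itv/= => /andP[xc1 c1y] /andP[yc2 c2z].
have c12 : c1 < c2 by exact: lt_trans c1y yc2.
have g1 (t : R) : t \in `[c1, c2] -> is_derive t 1 g (dg t).
  by move=> ti; apply: gdg; exact: (sub c1 c2 t (ltW xc1) (ltW c2z)).
have [c3 c3c e3] := @MVT_is_derive R g dg c1 c2 c12 g1.
have dgc3 : dg c3 <= 0.
  apply: dg0; apply: (sub c1 c2 c3 (ltW xc1) (ltW c2z)).
  exact: subset_itv_oo_cc.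
have gc : g c2 <= g c1 by rewrite -subr_le0 e3 mulr_le0_ge0// subr_ge0 ltW.
rewrite e1 e2 mulrAC; apply: ler_wpM2r; first by rewrite subr_ge0 ltW.
by apply: ler_wpM2r => //; rewrite subr_ge0 ltW.
Qed.

(* The chord inequality through [h ^+ 2 < h < s] is divided by [h]. *)
Lemma concave_chord_le0 (R : realType) (f : R -> R) (s A K : R) : 0 < s ->
  (forall h : R, 0 < h -> h <= 1 -> h <= s -> - (A * h) <= f h) ->
  (forall h : R, 0 < h -> h <= s / 2 -> f h <= K * h ^+ 2) ->
  (forall x y : R, 0 < x -> x < y -> y < s ->
     (f s - f y) * (y - x) <= (f y - f x) * (s - y)) ->
  f s <= 0.
Proof.
move=> s0 fA fK fC; rewrite leNgt; apply/negP => fs0.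
pose B := `|K| + `|A| + 1; have B0 : 0 < B by rewrite /B ltr_wpDl ?addr_ge0.
(* The first bound on [h] gives [h - h ^+ 2 >= h / 2], the second puts [h] in the range of [fK]. The
   third gives [B * h * s <= f s / 4], against the [f s / 2 <= B * h * s] that the chord will
   yield. *)
pose h := Num.min (Num.min (1 / 2) (s / 2)) (f s / (4 * B * s)).
have h0 : 0 < h.
  by rewrite !lt_min !divr_gt0// ?mulr_gt0.
have h1 : h <= 1 / 2 by rewrite /h !ge_min lexx.
have h2 : h <= s / 2 by rewrite /h !ge_min lexx orbT.
have h3 : h * (4 * B * s) <= f s.
  by rewrite -ler_pdivlMr ?mulr_gt0// /h ge_min lexx orbT.
have hh : h ^+ 2 < h by rewrite expr2 -[ltRHS]mulr1 ltr_pM2l//; lra.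
have hh0 : 0 < h ^+ 2 by rewrite exprn_gt0.
have chord := fC _ _ hh0 hh ltac:(lra).
have {fK}w_le : f h <= `|K| * h ^+ 2.
  by apply: le_trans (fK _ h0 h2) _; rewrite ler_wpM2r ?ler_norm// ltW.
have {fA}u_ge : - (`|A| * h ^+ 2) <= f (h ^+ 2).
  apply: le_trans (fA _ hh0 _ _); [|lra|lra].
  by rewrite lerN2 ler_wpM2r ?ler_norm// ltW.
have w_le' : f h * (s - h ^+ 2) <= `|K| * h ^+ 2 * s.
  apply: (@le_trans _ _ (`|K| * h ^+ 2 * (s - h ^+ 2))).
    by apply: ler_wpM2r => //; lra.
  by apply: ler_wpM2l; [rewrite mulr_ge0// ltW|lra].
have u_ge' : - (`|A| * h ^+ 2 * s) <= f (h ^+ 2) * (s - h).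
  apply: (@le_trans _ _ (- (`|A| * h ^+ 2) * (s - h))).
    by rewrite mulNr lerN2; apply: ler_wpM2l; [rewrite mulr_ge0// ltW|lra].
  by apply: ler_wpM2r => //; lra.
(* The chord inequality rearranges to [f s * (h - h ^+ 2) <= f h * (s - h ^+ 2) - f (h ^+ 2) * (s -
   h)]. *)
have upper : f s * (h - h ^+ 2) <= B * h ^+ 2 * s.
  have hs0 : 0 <= h ^+ 2 * s by rewrite mulr_ge0 ?ltW.
  by rewrite /B; lra.
have lower : f s * (h / 2) <= f s * (h - h ^+ 2).
  by apply: ler_wpM2l; [exact: ltW|rewrite expr2; nra].
have : f s * (h / 2) <= B * h ^+ 2 * s by exact: le_trans lower upper.
have -> : B * h ^+ 2 * s = h * (4 * B * s) * (h / 4) by field.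
have h40 : 0 <= h / 4 by lra.
move/(ler_wpM2r h40) : h3 => /[swap] /le_trans /[apply].
have fh0 : 0 < f s * h by rewrite mulr_gt0.
by lra.
Qed.

(** * The sub-Gaussian bound for a real variable whose tilted variances are bounded *)

Section tilted_variance.
Context (d : measure_display) (T : measurableType d) (R : realType)
  (mu : {measure set T -> \bar R}) (Y : T -> R) (smax : \bar R) (v : R).
Hypothesis mu1 : mu [set: T] = 1%E.
Hypothesis mY : measurable_fun [set: T] Y.
Hypothesis smax0 : (0 < smax)%E.
Hypothesis Yfin : forall s, tilt_domain smax s ->
  (\int[mu]_x (expR (- (s * Y x)))%:E < +oo)%E.
Hypothesis Yvar : forall s, tilt_domain smax s -> exists a : R,
  (\int[mu]_x ((Y x - a) ^+ 2 * expR (- (s * Y x)))%:E <=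
   v%:E * \int[mu]_x (expR (- (s * Y x)))%:E)%E.
Hypothesis Ymean : 0 <= \int[mu]_x Y x.

Let D0 : tilt_domain smax 0. Proof. by split. Qed.

Let integrable_real_cst (r : R) : mu.-integrable [set: T] (EFin \o cst r).
Proof.
apply/integrableP; split; first exact/measurable_EFinP/measurable_cst.
by rewrite (eq_integral (cst `|r%:E|%E))// integral_cst// mu1 mule1 ltry.
Qed.

Let Rintegral_const (r : R) : \int[mu]_x r = r.
Proof. by rewrite Rintegral_cst// mu1/= mulr1. Qed.

(** At [s = 0] the weight is 1, so [Yvar] bounds the second moment about [a]; then
    [Y ^+ 2 <= 2 * (Y - a) ^+ 2 + 2 * a ^+ 2]. *)
Let integrable_sqr : mu.-integrable [set: T] (EFin \o (fun x => Y x ^+ 2)).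
Proof.
have [a] := Yvar D0.
under eq_integral do rewrite mul0r oppr0 expR0 mulr1.
under [X in (_ <= _ * X)%E]eq_integral do rewrite mul0r oppr0 expR0.
rewrite integral_cst// mu1 !mule1 => le_v.
have mYa : measurable_fun [set: T] (fun x => Y x - a).
  exact: measurable_funB.
have i1 : mu.-integrable [set: T] (EFin \o (fun x => (Y x - a) ^+ 2)).
  apply/integrableP; split; first exact/measurable_EFinP/measurable_funX.
  under eq_integral do rewrite gee0_abs ?lee_fin ?sqr_ge0//.
  exact: le_lt_trans le_v (ltry _).
have i2 : mu.-integrable [set: T]
    (EFin \o (fun x => 2 * (Y x - a) ^+ 2 + 2 * a ^+ 2)).
  rewrite /comp; under eq_fun do rewrite EFinD EFinM.
  apply: integrableD => //; first exact: integrableZl.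
  exact: integrable_real_cst.
apply: (le_integrable _ _ _ i2) => //.
  exact/measurable_EFinP/measurable_funX.
move=> x _; rewrite /= lee_fin !ger0_norm ?sqr_ge0//.
  by have := sqr_ge0 (Y x - a - a); rewrite !expr2; nra.
by rewrite addr_ge0// mulr_ge0// sqr_ge0.
Qed.

Let integrable_Y : mu.-integrable [set: T] (EFin \o Y).
Proof.
have i2 : mu.-integrable [set: T] (EFin \o (fun x => Y x ^+ 2 + 1)).
  rewrite /comp; under eq_fun do rewrite EFinD.
  by apply: integrableD => //; exact: integrable_real_cst.
apply: (le_integrable _ _ _ i2) => //; first exact/measurable_EFinP.
move=> x _; rewrite /= lee_fin [leRHS]ger0_norm ?addr_ge0 ?sqr_ge0//.
by rewrite ler_norml !expr2; apply/andP; split; nra.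
Qed.

Let m : R := \int[mu]_x Y x.
Let M := tilted_moment mu Y.

Let M0E s : M 0 s = \int[mu]_x expR (- (s * Y x)).
Proof. by apply: eq_Rintegral => x _; rewrite expr0 mul1r. Qed.

Let EFin_M0 s : tilt_domain smax s ->
  (\int[mu]_x (expR (- (s * Y x)))%:E = (M 0 s)%:E)%E.
Proof.
move=> sD; rewrite M0E /Rintegral fineK//.
exact: (integrable_fin_num measurableT (integrable_expRN mY Yfin sD)).
Qed.

Let mgf_ge (s : R) : tilt_domain smax s -> expR (- (s * m)) <= M 0 s.
Proof.
move=> sD; rewrite M0E.
(* [a + b * y] is the tangent line of [expR (- (s * y))] at [y = m]; integrating it gives Jensen's
   inequality. *)
pose a := expR (- (s * m)) * (1 + s * m); pose b := - (expR (- (s * m)) * s).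
have i1 : mu.-integrable [set: T] (EFin \o (fun x => a + b * Y x)).
  rewrite /comp; under eq_fun do rewrite EFinD [X in (_ + X)%E]EFinM.
  apply: integrableD => //; [exact: integrable_real_cst|exact: integrableZl].
apply: le_trans (le_Rintegral measurableT i1 (integrable_expRN mY Yfin sD) _).
  rewrite RintegralD//; last 2 first.
  - exact: integrable_real_cst.
  - by rewrite /comp; under eq_fun do rewrite EFinM; exact: integrableZl.
  rewrite Rintegral_const RintegralZl// -/m /a /b le_eqVlt; apply/orP; left.
  by apply/eqP; ring.
move=> x _; have -> : - (s * Y x) = - (s * m) + - (s * (Y x - m)) by ring.
rewrite /a /b expRD; have := expR_ge1Dx (- (s * (Y x - m))).
by move/(ler_wpM2l (expR_ge0 (- (s * m)))); apply: le_trans; lra.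
Qed.

Let mgf_gt0 s : tilt_domain smax s -> 0 < M 0 s.
Proof. by move/mgf_ge; apply: lt_le_trans; rewrite expR_gt0. Qed.

(** Apply [expR_le_quadratic] at [- (h * Y)] and bound the exponential in its remainder by
    [1 + expR (- (b * Y))], which does not depend on [h]. The linear term integrates to
    [- (h * m) <= 0]. *)
Let mgf_le (b : R) : 0 < b -> (b%:E < smax)%E -> exists K : R, forall h : R,
  0 < h -> h <= b -> M 0 h <= 1 + K * h ^+ 2.
Proof.
move=> b0 bm; exists (2 * \int[mu]_x (Y x ^+ 2) + M 2 b) => h h0 hb.
have hD : tilt_domain smax h.
  by split; [exact: ltW|apply: le_lt_trans bm; rewrite lee_fin].
have ib := integrable_tilted mY Yfin 2 b0 bm.
pose q x := h ^+ 2 * (2 * Y x ^+ 2 + Y x ^+ 2 * expR (- (b * Y x))).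
have iq : mu.-integrable [set: T] (EFin \o q).
  rewrite /q /comp; under eq_fun do rewrite EFinM EFinD [X in (_ * (X + _))%E]EFinM.
  by apply: integrableZl => //; apply: integrableD => //; exact: integrableZl.
have i2 : mu.-integrable [set: T] (EFin \o (fun x => 1 + - h * Y x)).
  rewrite /comp; under eq_fun do rewrite EFinD EFinM.
  apply: integrableD => //; [exact: integrable_real_cst|exact: integrableZl].
have i1 : mu.-integrable [set: T] (EFin \o (fun x => (1 + - h * Y x) + q x)).
  by rewrite /comp; under eq_fun do rewrite EFinD; exact: integrableD.
rewrite M0E.
apply: le_trans (le_Rintegral measurableT (integrable_expRN mY Yfin hD) i1 _) _.
  move=> x _; apply: le_trans (expR_le_quadratic _) _.
  have := @expRN_le_add R 0 b h (Y x).
  rewrite mul0r oppr0 expR0 ltW// hb => /(_ isT) ebh.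
  have Y2 := sqr_ge0 (h * Y x).
  have := ler_wpM2l Y2 ebh.
  by rewrite /q sqrrN; rewrite exprMn in Y2 *; lra.
rewrite RintegralD// RintegralD//; last 2 first.
- exact: integrable_real_cst.
- by rewrite /comp; under eq_fun do rewrite EFinM; exact: integrableZl.
rewrite Rintegral_const RintegralZl// -/m.
rewrite /q RintegralZl//; last first.
  rewrite /comp; under eq_fun do rewrite EFinD EFinM.
  by apply: integrableD => //; exact: integrableZl.
rewrite RintegralD//; last first.
  by rewrite /comp; under eq_fun do rewrite EFinM; exact: integrableZl.
rewrite RintegralZl//.
have hm : 0 <= h * m by rewrite mulr_ge0// ltW.
by rewrite /M /tilted_moment; lra.
Qed.

(** The integral in [Yvar] expands to [M 2 - 2 a M 1 + a^2 M 0]. After multiplication by [M 0], the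
    center [a] disappears through [0 <= (a * M 0 - M 1) ^+ 2]. *)
Let tilted_variance_le (s : R) : 0 < s -> (s%:E < smax)%E ->
  M 2 s * M 0 s - M 1 s ^+ 2 <= v * M 0 s ^+ 2.
Proof.
move=> s0 sm; have sD : tilt_domain smax s by split => //; exact: ltW.
have [a] := Yvar sD.
have i0 := integrable_expRN mY Yfin sD.
have i1 := integrable_tilted mY Yfin 1 s0 sm.
have i2 := integrable_tilted mY Yfin 2 s0 sm.
have il : mu.-integrable [set: T] (EFin \o (fun x =>
    (- (2 * a)) * (Y x ^+ 1 * expR (- (s * Y x))) + a ^+ 2 * expR (- (s * Y x)))).
  rewrite /comp; under eq_fun do rewrite EFinD !EFinM -EFinM.
  by apply: integrableD => //; exact: integrableZl.
have E x : (Y x - a) ^+ 2 * expR (- (s * Y x)) =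
    Y x ^+ 2 * expR (- (s * Y x)) +
    ((- (2 * a)) * (Y x ^+ 1 * expR (- (s * Y x))) + a ^+ 2 * expR (- (s * Y x))).
  by rewrite expr1; ring.
have i3 : mu.-integrable [set: T]
    (EFin \o (fun x => (Y x - a) ^+ 2 * expR (- (s * Y x)))).
  rewrite /comp; under eq_fun do rewrite E EFinD.
  exact: integrableD.
have -> : (\int[mu]_x ((Y x - a) ^+ 2 * expR (- (s * Y x)))%:E =
    (M 2 s - 2 * a * M 1 s + a ^+ 2 * M 0 s)%:E)%E.
  rewrite -(fineK (integrable_fin_num measurableT i3)); congr EFin.
  transitivity (\int[mu]_x (Y x ^+ 2 * expR (- (s * Y x)) +
    ((- (2 * a)) * (Y x ^+ 1 * expR (- (s * Y x))) + a ^+ 2 * expR (- (s * Y x))))).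
    by apply: eq_Rintegral => x _; rewrite E.
  rewrite RintegralD// RintegralD//; last 2 first.
  - by rewrite /comp; under eq_fun do rewrite EFinM; exact: integrableZl.
  - by rewrite /comp; under eq_fun do rewrite EFinM; exact: integrableZl.
  by rewrite RintegralZl// RintegralZl// M0E /M /tilted_moment; ring.
have M0 := mgf_gt0 sD; rewrite EFin_M0// -EFinM lee_fin => /(ler_wpM2r (ltW M0)).
have := sqr_ge0 (a * M 0 s - M 1 s); rewrite !expr2; nra.
Qed.

Lemma mgf_le_of_tilted_variance (s : R) : tilt_domain smax s ->
  (\int[mu]_x (expR (- (s * Y x)))%:E <= (expR (v * s ^+ 2 / 2))%:E)%E.
Proof.
move=> sD; have [s0 sm] := sD.
rewrite EFin_M0// lee_fin.
move: s0; rewrite le_eqVlt => /predU1P[s0|s0].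
  rewrite M0E -s0; under eq_Rintegral do rewrite mul0r oppr0 expR0.
  by rewrite Rintegral_const expr0n/= mulr0 mul0r expR0.
have dom (t : R) : 0 < t -> t <= s -> (t%:E < smax)%E.
  by move=> t0 ts; apply: le_lt_trans sm; rewrite lee_fin.
pose f t := ln (M 0 t) - v * t ^+ 2 / 2.
suff : f s <= 0.
  rewrite /f subr_le0 -(@ler_expR R) lnK//; exact: mgf_gt0.
have s2 : 0 < s / 2 by rewrite divr_gt0.
have [K MK] := mgf_le s2 (dom _ s2 ltac:(lra)).
(* The summands [m] and [K] come from [mgf_ge] and [mgf_le]; the two [|v|] absorb [v * h ^+ 2 / 2],
   for the lower bound with [h ^+ 2 <= h] on [h <= 1]. *)
apply: (@concave_chord_le0 R f s (m + `|v|) (K + `|v|)) => //.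
- move=> h h0 h1 hs; have hm := dom h h0 hs.
  have hD : tilt_domain smax h by split; rewrite ?ltW.
  have : - (h * m) <= ln (M 0 h).
    by rewrite -(@expRK R (- (h * m))) ler_ln ?posrE ?expR_gt0 ?mgf_gt0// mgf_ge.
  have : v * h ^+ 2 / 2 <= `|v| * h.
    have vv := ler_norm v; have v0 := normr_ge0 v.
    have hh : h ^+ 2 <= h by rewrite expr2; nra.
    have : `|v| * h ^+ 2 <= `|v| * h by exact: ler_wpM2l.
    have : v * h ^+ 2 <= `|v| * h ^+ 2 by rewrite ler_wpM2r// sqr_ge0.
    have : 0 <= `|v| * h by rewrite mulr_ge0// ltW.
    by lra.
  by rewrite /f; lra.
- move=> h h0 hs.
  have hs' : h <= s by lra.
  have hD : tilt_domain smax h by split; [exact: ltW|exact: dom].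
  have h1 := MK h h0 hs.
  have : ln (M 0 h) <= K * h ^+ 2.
    rewrite -(@expRK R (K * _)) ler_ln ?posrE ?expR_gt0 ?mgf_gt0//.
    exact: le_trans h1 (expR_ge1Dx _).
  have : - (v * h ^+ 2) <= `|v| * h ^+ 2.
    by rewrite -mulNr ler_wpM2r ?sqr_ge0// -normrN ler_norm.
  have : 0 <= `|v| * h ^+ 2 by rewrite mulr_ge0 ?sqr_ge0.
  by rewrite /f; lra.
- move=> x y x0 xy ys.
  (* [g] and [dg] are the first and second derivatives of [f]; [dg] is the tilted variance minus
     [v]. *)
  pose g t := - M 1 t / M 0 t - v * t.
  pose dg t := (M 2 t * M 0 t - M 1 t ^+ 2) / M 0 t ^+ 2 - v.
  have tD (t : R) : t \in `[x, s] ->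
      [/\ 0 < t, (t%:E < smax)%E & 0 < M 0 t].
    rewrite in_itv/= => /andP[xt ts]; have t0 : 0 < t by lra.
    have tm := dom t t0 ts; split => //; apply: mgf_gt0; split => //.
    exact: ltW.
  apply: (@is_derive2_le0_chord R f g dg) => //.
  + move=> t /tD[t0 tm M0]; have dM := is_derive_tilted_moment mY Yfin 0 t0 tm.
    have dln := is_derive1_ln M0.
    have -> : f = (@ln R \o M 0) - ((v / 2) \*: (id * id : R -> R)).
      by apply/funext => u; rewrite /f mulrAC expr2.
    apply: is_derive_eq; rewrite /g /GRing.scale/= /M.
    by field; rewrite gt_eqF.
  + move=> t /tD[t0 tm M0].
    have dM0 := is_derive_tilted_moment mY Yfin 0 t0 tm.
    have dM1 := is_derive_tilted_moment mY Yfin 1 t0 tm.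
    have M0n : M 0 t != 0 by rewrite gt_eqF.
    have dV := is_deriveV M0n dM0.
    have -> : g = (- M 1) * (fun u => (M 0 u)^-1) - (v \*: (id : R -> R)).
      by apply/funext => u; rewrite /g.
    apply: is_derive_eq; rewrite /dg /GRing.scale/= -/M.
    by rewrite -[(- M 1) t]/(- M 1 t); field; rewrite gt_eqF.
  + move=> t /tD[t0 tm M0]; rewrite /dg subr_le0 ler_pdivrMr ?exprn_gt0//.
    exact: tilted_variance_le.
Qed.

End tilted_variance.

(** * Legendre transform of a truncated quadratic *)

Local Open Scope ereal_scope.

Section quadratic_rate.
Context (R : realType) (smax : \bar R) (V x : R).
Hypotheses (smax0 : 0 < smax) (V0 : (0 <= V)%R) (x0 : (0 <= x)%R).

Let Psi (s : R) : \bar R := (V * s ^+ 2 / 2)%:E.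
Let q (s : R) : R := (s * x - V * s ^+ 2 / 2)%R.

Let objE s : rate_objective Psi x s = (q s)%:E.
Proof. by []. Qed.

(* The derivative [x - V * r] of the objective is [0] at the optimum [r], or
   positive at the right end of the domain; the optimum escapes to infinity if
   [smax = +oo] and [V = 0 < x]. *)
Variant optimal_tilt_spec : \bar R -> Prop :=
| OptimalTiltInterior (r : R) of (0 <= r)%R & r%:E <= smax & (V * r = x)%R :
    optimal_tilt_spec r%:E
| OptimalTiltEnd (r : R) of (0 <= r)%R & smax = r%:E & (V * r < x)%R :
    optimal_tilt_spec r%:E
| OptimalTiltInfinite of smax = +oo & V = 0%R & (0 < x)%R :
    optimal_tilt_spec +oo.

Lemma optimal_tiltP : optimal_tilt_spec (optimal_tilt smax V x).
Proof.
rewrite /optimal_tilt inver.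
have [V_0|VN0] := eqVneq V 0%R.
  (* Dividing by [V = 0] means multiplying by [+oo]: the quotient is [0] for [x = 0] and [+oo] for
     [0 < x], and in the latter case the minimum is [smax]. *)
  move: x0; rewrite le_eqVlt => /predU1P[x_0|x_gt0].
    rewrite -x_0 mul0e min_l ?(ltW smax0)//.
    by apply: (@OptimalTiltInterior 0%R); rewrite ?(ltW smax0)// mulr0.
  rewrite gt0_muley ?lte_fin//.
  have := smax0; case smaxE: smax => [m| |] // m0.
    rewrite min_r ?leey//; apply: OptimalTiltEnd => //.
      by rewrite -lee_fin ltW.
    by rewrite V_0 mul0r.
  by rewrite minxx; apply: OptimalTiltInfinite.
have V_gt0 : (0 < V)%R by rewrite lt0r VN0.
rewrite -EFinM; have [le_s|lt_s] := leP (x / V)%:E smax.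
  by apply: OptimalTiltInterior; rewrite ?divr_ge0// mulrC divfK.
have := smax0; case smaxE: smax lt_s => [m| |] // lt_s m0.
apply: OptimalTiltEnd => //; first by rewrite -lee_fin ltW.
by move: lt_s; rewrite lte_fin ltr_pdivlMr// mulrC.
Qed.

(** Both optimality and uniqueness are read off the sign of the second factor. *)
Let q_sub r s : (q r - q s = (r - s) * (x - V * (r + s) / 2))%R.
Proof. by rewrite /q; field. Qed.

Let q_le r s : (V * r = x)%R -> (q s <= q r)%R.
Proof.
move=> Vr; rewrite -subr_ge0 q_sub -Vr.
have -> : ((r - s) * (V * r - V * (r + s) / 2) = V * (r - s) ^+ 2 / 2)%R by field.
by rewrite divr_ge0// mulr_ge0// sqr_ge0.
Qed.

Let q_le_end r s : (V * r < x)%R -> (s <= r)%R -> (q s <= q r)%R.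
Proof.
move=> Vr sr; rewrite -subr_ge0 q_sub mulr_ge0 ?subr_ge0//.
have : (V * s <= V * r)%R by exact: ler_wpM2l.
by lra.
Qed.

(** An infinite optimum occurs only for [V = 0 < x], where [q s = s * x] is unbounded; hence the
    value [+oo]. *)
Definition quadratic_rate (s : \bar R) : \bar R :=
  if s is r%:E then (q r)%:E else +oo.

Let q_cvg (u : R^nat) (r : R) :
  u k @[k --> \oo] --> r -> rate_objective Psi x (u k) @[k --> \oo] --> (q r)%:E.
Proof.
move=> ur; under eq_fun do rewrite objE.
apply: cvg_EFin; first exact: nearW.
apply: cvgB; first exact: cvgMr_tmp.
apply: cvgMr_tmp; apply: cvgMl_tmp.
by rewrite expr2; under eq_fun do rewrite expr2; exact: cvgM.
Qed.

Lemma rate_function_ub s : tilt_domain smax s ->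
  rate_objective Psi x s <= quadratic_rate (optimal_tilt smax V x).
Proof.
move=> [s0 sm]; rewrite objE; case: optimal_tiltP => [r r0 rm Vr|r r0 rm Vr|*].
- by rewrite lee_fin q_le.
- by rewrite lee_fin q_le_end// ltW// -lte_fin -rm.
- by rewrite leey.
Qed.

Lemma rate_function_approx : exists u : R^nat, [/\ forall k, tilt_domain smax (u k),
    (u k)%:E @[k --> \oo] --> optimal_tilt smax V x &
    rate_objective Psi x (u k) @[k --> \oo] -->
      quadratic_rate (optimal_tilt smax V x)].
Proof.
have fin (r : R) : (0 <= r)%R -> r%:E <= smax -> exists u : R^nat,
    [/\ forall k, tilt_domain smax (u k), (u k)%:E @[k --> \oo] --> r%:E &
    rate_objective Psi x (u k) @[k --> \oo] --> (q r)%:E].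
  (* The factor keeps [u k] strictly below [smax] even when [r = smax]; for [r = 0] the sequence is
     constantly 0. *)
  move=> r0 rm; pose u k : R := (r * (1 - k.+1%:R^-1))%R.
  have ur : u k @[k --> \oo] --> r.
    rewrite -[X in _ --> X]mulr1; apply: cvgMl_tmp; rewrite -[X in _ --> X]subr0.
    by apply: cvgB; [exact: cvg_cst|exact: cvg_harmonic].
  exists u; split; [|exact: cvg_EFin (nearW _ _) ur|exact: q_cvg] => k.
  have k1 : (k.+1%:R^-1 <= 1 :> R)%R by rewrite invf_le1// ler1n.
  split; first by rewrite mulr_ge0// subr_ge0.
  have [r_0|rN0] := eqVneq r 0%R; first by rewrite /u r_0 mul0r.
  have r_gt0 : (0 < r)%R by rewrite lt0r rN0.
  by apply: lt_le_trans rm; rewrite lte_fin /u gtr_pMr// gtrBl.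
case: optimal_tiltP => [r r0 rm _|r r0 rm _|smax_oo V_0 x_gt0].
- exact: fin.
- by apply: fin => //; rewrite rm.
- exists (fun k => k%:R); split.
  + by move=> k; split => //; rewrite smax_oo ltry.
  + exact/cvgenyP.
  + rewrite /=; apply/cvgeyPge => A.
    near=> k; rewrite objE /q V_0 !mul0r subr0 lee_fin -ler_pdivrMr//.
    near: k; exact: nbhs_infty_ger.
Unshelve. all: by end_near. Qed.

Lemma rate_functionE :
  rate_function smax Psi x = quadratic_rate (optimal_tilt smax V x).
Proof.
apply/eqP; rewrite eq_le; apply/andP; split.
  by apply: ge_ereal_sup => _ [s sD <-]; exact: rate_function_ub.
have [u [uD _ uq]] := rate_function_approx.
rewrite -(cvg_lim _ uq)//; apply: lime_le; first by apply/cvg_ex; eexists; exact: uq.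
by apply: nearW => k; apply: ereal_sup_ubound; exists (u k).
Qed.

Lemma sup_approached_optimal_tilt :
  sup_approached_at smax Psi x (optimal_tilt smax V x).
Proof.
by have [u [uD us uq]] := rate_function_approx; exists u; rewrite rate_functionE.
Qed.

Lemma rate_function_le : x%:E <= smax * V%:E ->
  rate_function smax Psi x = (x ^+ 2)%:E / (2 * V)%:E.
Proof.
rewrite rate_functionE; case: optimal_tiltP => [r r0 rm Vr _|r r0 -> Vr|-> -> x_gt0].
(* If [V = 0] then [x = 0], and the quotient on the right is [0 * +oo = 0], as it should be. *)
- rewrite /= inver mulf_eq0 pnatr_eq0/=; have [V_0|VN0] := eqVneq V 0%R.
    by rewrite /q -Vr V_0 !mul0r mulr0 subr0 expr0n mul0e.
  by rewrite -EFinM; congr (_%:E); rewrite /q -Vr; field.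
- by rewrite -EFinM lee_fin leNgt mulrC Vr.
- by rewrite mule0 lee_fin leNgt x_gt0.
Qed.

Lemma rate_function_gt : smax * V%:E < x%:E ->
  rate_function smax Psi x = smax * x%:E - V%:E * smax ^+ 2 / 2%:E.
Proof.
rewrite rate_functionE; case: optimal_tiltP => [r r0 rm Vr|r r0 -> Vr _|-> -> x_gt0 _].
- rewrite ltNge -Vr mulrC EFinM => /negP; case; apply: lee_wpmul2r => //.
- rewrite /= inver pnatr_eq0/=.
  by congr EFin; rewrite /q; field.
(* Here [smax = +oo] and [V = 0]: the quadratic term is [0 * +oo = 0], and the linear one is
   [+oo]. *)
- by rewrite /= !mul0e sube0 gt0_mulye.
Qed.

(** The condition on [x] and [V] excludes [x = V = 0], where the objective vanishes identically and
    every tilt is optimal. A finite limit attains the optimum of [q] by continuity, and [q_sub]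
    identifies it; an infinite one is possible only if [V = 0]. *)
Lemma sup_approached_unique (s : \bar R) : (0 < x)%R \/ (0 < V)%R ->
  sup_approached_at smax Psi x s -> s = optimal_tilt smax V x.
Proof.
move=> xV [u [uD us uq]]; rewrite rate_functionE in uq.
have s_ge0 : 0 <= s.
  rewrite -(cvg_lim _ us)//; apply: lime_ge; first by apply/cvg_ex; exists s.
  by apply: nearW => k; rewrite lee_fin; have [] := uD k.
have s_le : s <= smax.
  rewrite -(cvg_lim _ us)//; apply: lime_le; first by apply/cvg_ex; exists s.
  by apply: nearW => k; rewrite ltW//; have [] := uD k.
have V_gt0 r : (V * r = x)%R -> (0 < V)%R.
  move=> Vr; rewrite lt0r V0 andbT; apply/eqP => V_0.
  by move: xV; rewrite -Vr V_0 mul0r ltxx => -[].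
case: s us s_ge0 s_le => [s| |] // us s0 sm.
  have {}us : u k @[k --> \oo] --> s by exact: (fine_cvg us).
  have : (q s)%:E = quadratic_rate (optimal_tilt smax V x).
    exact: (cvg_unique (@ereal_hausdorff R) (q_cvg us) uq).
  clear uq.
  case: optimal_tiltP => [r r0 rm Vr|r r0 smax_r Vr|_ _ _] //= [qE].
  - have : (V * (r - s) ^+ 2 / 2 = 0)%R.
      by rewrite -(subrr (q s)) {1}qE q_sub -Vr; field.
    move/eqP; rewrite !mulf_eq0 invr_eq0 pnatr_eq0/= orbF.
    by rewrite gt_eqF ?(V_gt0 r)//= orbb subr_eq0 => /eqP ->.
  - rewrite smax_r lee_fin in sm.
    have : (V * s <= V * r)%R by exact: ler_wpM2l.
    have : ((r - s) * (x - V * (r + s) / 2) = 0)%R by rewrite -q_sub -qE subrr.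
    move/eqP; rewrite mulf_eq0 => /orP[|/eqP]; last by move=> h h2; exfalso; lra.
    by rewrite subr_eq0 => /eqP ->.
have smax_oo : smax = +oo by apply/eqP; rewrite -leye_eq.
case: optimal_tiltP uq => [r r0 rm Vr|r r0 smax_r _|//] /= uq; last first.
  by rewrite smax_r in smax_oo.
have {}V_gt0 := V_gt0 _ Vr.
have qr0 : (0 <= q r)%R.
  have -> : (q r = V * r ^+ 2 / 2)%R by rewrite /q -Vr; field.
  by rewrite divr_ge0// mulr_ge0// sqr_ge0.
have : (q r)%:E <= (-1)%:E.
  rewrite -(cvg_lim _ uq)//; apply: lime_le; first by apply/cvg_ex; eexists; exact: uq.
  move/cvgeyPge : us => us; near=> k; rewrite objE lee_fin /q.
  have u1 : (1 <= u k)%R by rewrite -lee_fin; near: k; exact: us.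
  (* With this bound [V * u k ^+ 2 / 2 >= u k * (x + 1)], so the objective is at most [- u k <= -1],
     whereas its limit [q r] is nonnegative. *)
  have u2 : (2 * (x + 1) / V <= u k)%R by rewrite -lee_fin; near: k; exact: us.
  rewrite ler_pdivrMr// in u2.
  have : (u k * (2 * (x + 1)) <= u k * (u k * V))%R by rewrite ler_wpM2l//; lra.
  by rewrite expr2; lra.
by rewrite lee_fin => h; exfalso; lra.
Unshelve. all: by end_near. Qed.

Lemma sup_attained_optimal_tilt : x%:E <= smax * V%:E ->
  optimal_tilt smax V x < smax ->
  sup_attained_at smax Psi x (optimal_tilt smax V x).
Proof.
move=> _; rewrite /sup_attained_at rate_functionE.
case: optimal_tiltP => [r r0 rm Vr|r r0 -> Vr|-> _ _]; rewrite ?ltxx// => rlt.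
by exists r; split.
Qed.

(** For a finite [smax] the objective increases strictly up to [smax], which lies outside the
    domain; for an infinite optimal tilt the supremum is [+oo], while the objective is finite. *)
Lemma sup_not_attained (s : \bar R) : smax * V%:E < x%:E ->
  ~ sup_attained_at smax Psi x s.
Proof.
move=> lt_x [r [_ [r0 rm]]]; rewrite rate_functionE.
case: optimal_tiltP lt_x rm => [z z0 zm Vz|z z0 -> Vz|//].
- rewrite ltNge -Vz mulrC EFinM => /negP; case; apply: lee_wpmul2r => //.
- move=> _; rewrite lte_fin => rz /= []; rewrite -/(q r) => /esym/eqP.
  rewrite -subr_eq0 q_sub.
  have : (V * r <= V * z)%R by rewrite ler_wpM2l// ltW.
  by rewrite mulf_eq0 => ? /orP[|] /eqP; lra.
Qed.

(** This covers both regimes of the rate by one expression: it is an equality at an interior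
    optimum, and at the end [r] the gap is [r * (x - V * r) / 2]. *)
Lemma half_optimal_tilt_le :
  (x / 2)%:E * optimal_tilt smax V x <= rate_function smax Psi x.
Proof.
rewrite rate_functionE; case: optimal_tiltP => [r r0 rm Vr|r r0 _ Vr|*];
  last exact: leey.
- by rewrite -EFinM lee_fin le_eqVlt /q -Vr; apply/orP; left; apply/eqP; field.
- rewrite -EFinM lee_fin /q -subr_ge0.
  have -> : (r * x - V * r ^+ 2 / 2 - x / 2 * r = r * (x - V * r) / 2)%R by field.
  by rewrite divr_ge0// mulr_ge0// subr_ge0 ltW.
Qed.

End quadratic_rate.

(** * Conditional expectations from regular conditional distributions *)

Section ge0_measurable_ind.
Context (d : measure_display) (T : measurableType d) (R : realType).
Variable Q : (T -> \bar R) -> Prop.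
Hypothesis Qindic : forall A, measurable A -> Q (fun x => (\1_A x)%:E).
Hypothesis QD : forall f g : T -> \bar R,
  (forall x, 0 <= f x) -> measurable_fun [set: T] f ->
  (forall x, 0 <= g x) -> measurable_fun [set: T] g ->
  Q f -> Q g -> Q (fun x => f x + g x).
Hypothesis QZ : forall (r : R) (f : T -> \bar R), (0 <= r)%R ->
  (forall x, 0 <= f x) -> measurable_fun [set: T] f ->
  Q f -> Q (fun x => r%:E * f x).
Hypothesis Qlim : forall f_ : nat -> T -> \bar R,
  (forall n x, 0 <= f_ n x) -> (forall n, measurable_fun [set: T] (f_ n)) ->
  (forall x, nondecreasing_seq (f_ ^~ x)) ->
  (forall n, Q (f_ n)) -> Q (fun x => limn (f_ ^~ x)).

Import HBNNSimple.

(** Every such function is an increasing limit of simple functions, and these are finite sums of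
    scaled indicators of their fibres. *)
Lemma ge0_measurable_ind (f : T -> \bar R) :
  (forall x, 0 <= f x) -> measurable_fun [set: T] f -> Q f.
Proof.
move=> f0 mf; pose f_ := nnsfun_approx measurableT mf.
have -> : f = fun x => limn (fun n => (f_ n x)%:E).
  apply/funext => x; apply/esym/cvg_lim => //.
  by apply: cvg_nnsfun_approx => //.
apply: (@Qlim (fun n x => (f_ n x)%:E)).
- by move=> n x; rewrite lee_fin.
- by move=> n; exact/measurable_EFinP.
- by move=> x m n mn; rewrite lee_fin; exact/lefP/nd_nnsfun_approx.
move=> n; set g := f_ n.
pose s : seq R := finmap.enum_fset (fset_set (range g)).
have -> : (fun x => (g x)%:E) =
    (fun x => \sum_(r <- s) (r * \1_(g @^-1` [set r]) x)%:E).
  apply/funext => x; rewrite sumEFin {1}fimfunE fsbig_finite//=.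
have s0 r : r \in s -> (0 <= r)%R.
  by rewrite /s in_fset_set// inE/= => -[x _ <-].
elim: s s0 => [|r s IH] s0.
  under eq_fun do rewrite big_nil.
  have := @Qindic set0 measurable0; under eq_fun do rewrite indic0 //.
  by [].
under eq_fun do rewrite big_cons.
have s0' : forall r, r \in s -> (0 <= r)%R.
  by move=> q qs; apply: s0; rewrite inE qs orbT.
have r0 : (0 <= r)%R by apply: s0; rewrite inE eqxx.
apply: QD.
- by move=> x; rewrite lee_fin mulr_ge0.
- exact/measurable_EFinP/measurable_funM.
- move=> x; rewrite big_seq; apply: sume_ge0 => q /s0' q0.
  by rewrite lee_fin mulr_ge0.
- apply: emeasurable_sum => q.
  exact/measurable_EFinP/measurable_funM.
- under eq_fun do rewrite EFinM.
  apply: QZ => //; first exact/measurable_EFinP.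
  exact: Qindic.
- exact: IH.
Qed.

End ge0_measurable_ind.

Lemma measurable_indicE (d : measure_display) (T : measurableType d)
    (R : realType) (A : set T) :
  measurable A -> measurable_fun [set: T] (fun x => (\1_A x : R)%:E).
Proof. by move=> mA; exact/measurable_EFinP. Qed.

Lemma indicE_ge0 (T : Type) (R : realType) (A : set T) x :
  0 <= (\1_A x : R)%:E.
Proof. by rewrite lee_fin. Qed.

Lemma ge0_integral_lim (d : measure_display) (T : measurableType d)
    (R : realType) (mu : {measure set T -> \bar R}) (D : set T)
    (f_ : nat -> T -> \bar R) :
  measurable D -> (forall n x, 0 <= f_ n x) ->
  (forall n, measurable_fun [set: T] (f_ n)) ->
  (forall x, nondecreasing_seq (f_ ^~ x)) ->
  \int[mu]_(x in D) limn (f_ ^~ x) = limn (fun n => \int[mu]_(x in D) f_ n x).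
Proof.
move=> mD f0 mf nd; apply: monotone_convergence => //.
by move=> n; exact: measurable_funTS.
Qed.

Lemma limn_ub_nd (R : realType) (u : nat -> \bar R) n :
  nondecreasing_seq u -> u n <= limn u.
Proof.
move=> ndu; rewrite (cvg_lim _ (ereal_nondecreasing_cvgn ndu))//.
by apply: ereal_sup_ubound; exists n.
Qed.

(** The delicate case is [a = +oo]: either some [u n] is positive and both sides are [+oo], or [u]
    vanishes and both are 0. *)
Lemma mule_limn_nd (R : realType) (a : \bar R) (u : nat -> \bar R) :
  0 <= a -> (forall n, 0 <= u n) -> nondecreasing_seq u ->
  a * limn u = limn (fun n => a * u n).
Proof.
move=> a0 u0 ndu.
have ndau : nondecreasing_seq (fun n => a * u n).
  by move=> m n mn; apply: lee_wpmul2l => //; exact: ndu.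
have cau := ereal_nondecreasing_is_cvgn ndau.
apply/eqP; rewrite eq_le; apply/andP; split; last first.
  apply: lime_le => //; apply: nearW => n.
  by apply: lee_wpmul2l => //; exact: limn_ub_nd.
have [afin|] := boolP (a \is a fin_num).
  by rewrite limeMl//; exact: ereal_nondecreasing_is_cvgn.
rewrite ge0_fin_numE// -leNgt leye_eq => /eqP a_oo.
have [[n un0]|u_0] := pselect (exists n, 0 < u n).
  have /= := limn_ub_nd n ndau; rewrite a_oo gt0_mulye// leye_eq => /eqP ->.
  exact: leey.
have u_eq0 : u = fun=> 0.
  apply/funext => n; apply/eqP; rewrite eq_le u0 andbT leNgt.
  by apply/negP => un0; apply: u_0; exists n.
by rewrite u_eq0 lim_cst// mule0 lim_cst.
Qed.

Lemma integral_mdensity (d : measure_display) (T : measurableType d)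
    (R : realType) (mu : {measure set T -> \bar R}) (rho : T -> \bar R)
    (rho0 : forall x, 0 <= rho x) (mrho : measurable_fun [set: T] rho)
    (f : T -> \bar R) :
  (forall x, 0 <= f x) -> measurable_fun [set: T] f ->
  \int[mdensity mu rho0 mrho]_x f x = \int[mu]_x (f x * rho x).
Proof.
move=> f0 mf.
apply: (@ge0_measurable_ind _ _ _ (fun f => \int[mdensity mu rho0 mrho]_x f x =
  \int[mu]_x (f x * rho x))) f0 mf => {f}.
- move=> A mA; rewrite integral_indic// setIT /mdensity/=.
  rewrite [LHS]integral_mkcond/=; apply: eq_integral => x _.
  by rewrite patchE indicE; case: ifP; rewrite ?mul1e ?mul0e.
- move=> f g f0 mf g0 mg fE gE.
  rewrite ge0_integralD// fE gE -ge0_integralD//.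
  + by apply: eq_integral => x _; rewrite ge0_muleDl.
  + by move=> x _; rewrite mule_ge0.
  + exact: emeasurable_funM.
  + by move=> x _; rewrite mule_ge0.
  + exact: emeasurable_funM.
- move=> r f r0 f0 mf fE.
  rewrite ge0_integralZl_EFin// fE -ge0_integralZl_EFin//.
  + by apply: eq_integral => x _; rewrite muleA.
  + by move=> x _; rewrite mule_ge0.
  + exact: emeasurable_funM.
- move=> f_ f0 mf nd fE.
  rewrite ge0_integral_lim//; under eq_fun do rewrite fE.
  rewrite -ge0_integral_lim//.
  + by apply: eq_integral => x _; rewrite muleC mule_limn_nd//;
      under eq_fun do rewrite muleC.
  + by move=> n x; rewrite mule_ge0.
  + by move=> n; exact: emeasurable_funM.
  + by move=> x m n mn; apply: lee_wpmul2r => //; exact: nd.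
Qed.

(** * Integration relative to a sub-sigma-algebra *)

Section sub_sigma_algebra.
Context (d : measure_display) (T : measurableType d) (R : realType)
  (P : probability T R) (G : set (set T)).
Hypotheses (sG : sigma_algebra setT G) (GT : G `<=` measurable).

Lemma measurable_g_sigma (A : set T) :
  measurable (A : set (g_sigma_algebraType G)) <-> G A.
Proof.
rewrite /measurable/= -[X in _ <-> X A](sigma_algebra_id sG).
by [].
Qed.

Lemma measurable_wrtT d' (U : measurableType d') (f : T -> U) :
  measurable_wrt G f -> measurable_fun [set: T] f.
Proof.
move=> mf _ B mB.
by have /measurable_g_sigma/GT := mf measurableT B mB.
Qed.

(** The assumed equality of integrals over sets of [G] is the case where [Z] is an indicator. *)
Lemma cexp_pull_out (X Y Z : T -> \bar R) :
  (forall w, 0 <= X w) -> measurable_fun [set: T] X ->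
  (forall w, 0 <= Y w) -> measurable_fun [set: T] Y ->
  (forall A, G A -> \int[P]_(w in A) Y w = \int[P]_(w in A) X w) ->
  measurable_wrt G Z -> (forall w, 0 <= Z w) ->
  \int[P]_w (Z w * Y w) = \int[P]_w (Z w * X w).
Proof.
move=> X0 mX Y0 mY XY mZ Z0.
apply: (@ge0_measurable_ind _ (g_sigma_algebraType G) _ (fun Z =>
  \int[P]_w (Z w * Y w) = \int[P]_w (Z w * X w))) Z0 mZ.
- move=> A /measurable_g_sigma GA.
  have E (V : T -> \bar R) :
      \int[P]_w ((\1_A w)%:E * V w) = \int[P]_(w in A) V w.
    rewrite [RHS]integral_mkcond/=; apply: eq_integral => x _.
    by rewrite patchE indicE; case: ifP; rewrite ?mul1e ?mul0e.
  by rewrite !E XY.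
- move=> f g f0 /measurable_wrtT mf g0 /measurable_wrtT mg fE gE.
  have E (V : T -> \bar R) : (forall w, 0 <= V w) ->
      measurable_fun [set: T] V -> \int[P]_w ((f w + g w) * V w) =
      \int[P]_w (f w * V w) + \int[P]_w (g w * V w).
    move=> V0 mV; rewrite -ge0_integralD//.
    + by apply: eq_integral => x _; rewrite ge0_muleDl.
    + by move=> x _; rewrite mule_ge0.
    + exact: emeasurable_funM.
    + by move=> x _; rewrite mule_ge0.
    + exact: emeasurable_funM.
  by rewrite !E// fE gE.
- move=> r f r0 f0 /measurable_wrtT mf fE.
  have E (V : T -> \bar R) : (forall w, 0 <= V w) ->
      measurable_fun [set: T] V -> \int[P]_w (r%:E * f w * V w) =
      r%:E * \int[P]_w (f w * V w).
    move=> V0 mV; rewrite -ge0_integralZl_EFin//.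
    + by apply: eq_integral => x _; rewrite muleA.
    + by move=> x _; rewrite mule_ge0.
    + exact: emeasurable_funM.
  by rewrite !E// fE.
- move=> f_ f0 mf nd fE.
  have {}mf n : measurable_fun [set: T] (f_ n).
    exact: measurable_wrtT (mf n).
  have E (V : T -> \bar R) : (forall w, 0 <= V w) ->
      measurable_fun [set: T] V ->
      \int[P]_w (limn (f_ ^~ w) * V w) = limn (fun n => \int[P]_w (f_ n w * V w)).
    move=> V0 mV; rewrite -ge0_integral_lim//.
    + by apply: eq_integral => x _; rewrite muleC mule_limn_nd//;
        under eq_fun do rewrite muleC.
    + by move=> n x; rewrite mule_ge0.
    + by move=> n; exact: emeasurable_funM.
    + by move=> x m n mn; apply: lee_wpmul2r => //; exact: nd.
  by rewrite !E//; congr (limn _); apply/funext => n.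
Qed.

(** For indicators [phi] this is the defining property of the regular conditional distribution. *)
Lemma integral_cond_dist (X : T -> \bar R)
    (k : R.-pker (g_sigma_algebraType G) ~> \bar R) (phi : \bar R -> \bar R)
    (A : set T) :
  measurable_fun [set: T] X -> is_regular_cond_dist P X k ->
  (forall x, 0 <= phi x) -> measurable_fun [set: \bar R] phi -> G A ->
  \int[P]_(w in A) \int[k w]_x phi x = \int[P]_(w in A) phi (X w).
Proof.
move=> mX Xk phi0 mphi GA; have mA := GT GA.
have mk (f : \bar R -> \bar R) : (forall x, 0 <= f x) ->
    measurable_fun [set: \bar R] f ->
    measurable_fun [set: T] (fun w => \int[k w]_x f x).
  move=> f0 mf; apply: measurable_wrtT.
  apply: (measurable_fun_integral_kernel (l := k)) => //.
  by move=> U mU; exact: measurable_kernel.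
have mXf (f : \bar R -> \bar R) : measurable_fun [set: \bar R] f ->
    measurable_fun [set: T] (f \o X).
  by move=> mf; exact: measurableT_comp.
apply: (@ge0_measurable_ind _ _ _ (fun phi =>
  \int[P]_(w in A) \int[k w]_x phi x = \int[P]_(w in A) phi (X w))) phi0 mphi.
- move=> B mB.
  under eq_integral do rewrite integral_indic// setIT.
  rewrite -Xk//.
  transitivity (\int[P]_(w in A) (\1_(X @^-1` B) w)%:E); last first.
    by apply: eq_integral => w _; rewrite !indicE.
  rewrite integral_indic// 1?setIC// -[X in measurable X]setTI.
  exact: mX.
- move=> f g f0 mf g0 mg fE gE.
  under eq_integral do rewrite ge0_integralD//.
  rewrite ge0_integralD//.
  + rewrite fE gE -ge0_integralD//; apply: measurable_funTS; exact: mXf.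
  + by move=> w _; exact: integral_ge0.
  + exact/measurable_funTS/mk.
  + by move=> w _; exact: integral_ge0.
  + exact/measurable_funTS/mk.
- move=> r f r0 f0 mf fE.
  under eq_integral do rewrite ge0_integralZl_EFin//.
  rewrite ge0_integralZl_EFin//.
  + rewrite fE -ge0_integralZl_EFin//; apply: measurable_funTS; exact: mXf.
  + by move=> w _; exact: integral_ge0.
  + exact/measurable_funTS/mk.
- move=> f_ f0 mf nd fE.
  under eq_integral do rewrite ge0_integral_lim//.
  rewrite ge0_integral_lim//.
  + under eq_fun do rewrite fE.
    rewrite -ge0_integral_lim//.
    by move=> n; exact/mXf.
  + by move=> n w; exact: integral_ge0.
  + by move=> n; exact/mk.
  + move=> w m n mn; apply: ge0_le_integral => //.
    by move=> x _; exact: nd.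
Qed.

End sub_sigma_algebra.

(** * Almost sure uniqueness of conditional expectations *)

Section cexp_unique.
Context (d : measure_display) (T : measurableType d) (R : realType)
  (P : probability T R) (G : set (set T)).
Hypotheses (sG : sigma_algebra setT G) (GT : G `<=` measurable).

(** The set where [Y < Y'] is covered by the sets where [Y <= q] and [r <= Y'], for rationals
    [q < r]. On such a set [B], [r * P B <= q * P B], so [P B = 0]. Cutting at [q] keeps these
    quantities finite even if [Y] is not integrable. *)
Lemma cexp_ae_le (Y Y' : T -> \bar R) :
  measurable_wrt G Y -> (forall w, 0 <= Y w) ->
  measurable_wrt G Y' -> (forall w, 0 <= Y' w) ->
  (forall A, G A -> \int[P]_(w in A) Y' w <= \int[P]_(w in A) Y w) ->
  {ae P, forall w, Y' w <= Y w}.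
Proof.
move=> mY Y0 mY' Y'0 Y'Y.
pose A (p : rat * rat) := [set w | Y w <= (ratr p.1)%:E] `&`
  [set w | (ratr p.2)%:E <= Y' w] `&` [set w | (ratr p.1 : R) < ratr p.2]%R.
(* The rational pairs are enumerated by their codes; integers that code no pair get the empty
   set. *)
pose N n := if unpickle n is Some p then A p else set0.
have NA n : measurable (N n) /\ P (N n) = 0.
  rewrite /N; case: unpickle => [[q r]|]; last by rewrite measure0.
  rewrite /A/=; have [qr|rq] := boolP ((ratr q : R) < ratr r)%R; last first.
    rewrite [X in _ `&` X](_ : _ = set0) ?setI0 ?measure0//.
    by apply/seteqP; split => // w /= /(negP rq).
  rewrite [X in _ `&` X](_ : _ = setT) ?setIT; last exact/seteqP.
  set B := _ `&` _.
  have GB : G B.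
    apply/(measurable_g_sigma sG); apply: measurableI.
      rewrite -[X in measurable X]setTI.
      exact: (emeasurable_fun_infty_c measurableT mY).
    rewrite -[X in measurable X]setTI.
    exact: (emeasurable_fun_c_infty measurableT mY').
  have mB := GT GB; split => //.
  have [[w [/= Yq _]]|B0] := pselect (exists w, B w); last first.
    have -> : B = set0 by apply/seteqP; split => // w Bw; apply: B0; exists w.
    by rewrite measure0.
  have q0 : (0 <= ratr q :> R)%R by rewrite -lee_fin (le_trans (Y0 w)).
  have : (ratr r)%:E * P B <= (ratr q)%:E * P B.
    rewrite -!integral_cst//; apply: (@le_trans _ _ (\int[P]_(w in B) Y' w)).
      apply: ge0_le_integral => //.
      - by move=> x _; rewrite lee_fin (le_trans q0)// ltW.
      - exact/measurable_funTS/(measurable_wrtT sG GT).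
      - by move=> x [].
    apply: (le_trans (Y'Y _ GB)); apply: ge0_le_integral => //.
    - exact/measurable_funTS/(measurable_wrtT sG GT).
    - by move=> x [].
  rewrite -(@fineK _ (P B)) ?fin_num_measure// -!EFinM !lee_fin => le_rq.
  congr EFin; apply/eqP; rewrite eq_le fine_ge0 ?andbT//.
  rewrite leNgt; apply/negP => PB0; move: le_rq.
  by rewrite ler_pM2r// leNgt qr.
have : P.-negligible (\bigcup_n N n).
  apply: negligible_bigcup => n; have [mN PN] := NA n.
  by exists (N n); split.
apply: negligibleS => w /= /negP; rewrite -ltNge => YY'.
have Yfin : Y w \is a fin_num by rewrite ge0_fin_numE// (lt_le_trans YY')// leey.
have [y' Yy' y'Y] : exists2 y' : R, (fine (Y w) < y')%R & y'%:E <= Y' w.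
  case: (Y' w) YY' => [y'| |].
  - by move=> YY'; exists y' => //; rewrite -lte_fin fineK.
  - by move=> _; exists (fine (Y w) + 1)%R; rewrite ?ltrDl ?leey.
  - by rewrite ltNge leNye.
have [q] := rat_in_itvoo Yy'; rewrite in_itv/= => /andP[Yq qy'].
have [r] := rat_in_itvoo qy'; rewrite in_itv/= => /andP[qr ry'].
have := pickleK (q, r); move: (pickle (q, r)) => n nE.
exists n; [by []|].
rewrite /N nE; split => //; split => /=.
  by rewrite -(fineK Yfin) lee_fin ltW.
by rewrite (le_trans _ y'Y)// lee_fin ltW.
Qed.

(** [cexp_ge0] is an arbitrarily chosen version; [cexp_ae_le] in both directions identifies it with
    any explicit one. *)
Lemma cexp_ge0_ae (X Y : T -> \bar R) :
  is_cexp P G X Y -> {ae P, forall w, cexp_ge0 P G X w = Y w}.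
Proof.
move=> XY; have [mY Y0 YE] := XY.
have [mZ Z0 ZE] : is_cexp P G X (cexp_ge0 P G X) by apply: getPex; exists Y.
have h1 : {ae P, forall w, cexp_ge0 P G X w <= Y w}.
  by apply: cexp_ae_le => // A GA; rewrite ZE// YE.
have h2 : {ae P, forall w, Y w <= cexp_ge0 P G X w}.
  by apply: cexp_ae_le => // A GA; rewrite ZE// YE.
by apply: filterS2 h1 h2 => w ? ?; apply/eqP; rewrite eq_le; apply/andP.
Qed.

Lemma cexp_ae (X Y : T -> \bar R) : (forall w, 0 <= X w) ->
  is_cexp P G X Y -> {ae P, forall w, cexp P G X w = Y w}.
Proof.
move=> X0 XY.
have X_pos : X^\+ = X by apply/funext => w; rewrite funeposE; apply/max_idPl.
have X_neg : X^\- = cst 0.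
  apply/funext => w; rewrite funenegE; apply/max_idPr.
  by rewrite leeNl oppe0.
have X_negE : is_cexp P G X^\- (cst 0).
  split=> // [|A GA]; first exact: measurable_cst.
  by rewrite X_neg.
have := cexp_ge0_ae XY; have := cexp_ge0_ae X_negE.
rewrite /cexp X_pos; apply: filterS2 => w -> ->.
by rewrite sube0.
Qed.

End cexp_unique.

(** * Tilts of a law on the extended real line *)

Section tilted_law.
Context (R : realType) (mu : {measure set (\bar R) -> \bar R}) (c v : R).
Hypothesis mu1 : mu [set: \bar R] = 1.

Lemma measurable_tilt_weight (s : R) :
  measurable_fun [set: \bar R] (tilt_weight c s).
Proof.
apply: (measurableT_comp (@measurable_expeR R)).
apply: measurableT_comp => //; apply: measurable_funeM.
exact: emeasurable_funB.
Qed.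

Lemma measurable_sqrB (a : \bar R) :
  measurable_fun [set: \bar R] (fun x => (x - a) ^+ 2).
Proof.
by under eq_fun do rewrite expe2; apply: emeasurable_funM; exact: emeasurable_funB.
Qed.

Lemma tilt_weight_ge0 (s : R) x : 0 <= tilt_weight c s x.
Proof. exact: expeR_ge0. Qed.

Lemma tilt_weight0 x : tilt_weight c 0 x = 1.
Proof. by rewrite /tilt_weight mul0e oppe0 expeR0. Qed.

Lemma tilt_norm0 : tilt_norm mu c 0 = 1.
Proof.
rewrite /tilt_norm; under eq_integral do rewrite tilt_weight0.
by rewrite integral_cst// mul1e.
Qed.

(* An infinite mean would make the variance infinite.  The finite mean [a] is
   never computed, as any center bounds the variance from above. *)
Lemma tilt_variance_center (s : R) :
  0 < tilt_norm mu c s -> tilt_norm mu c s < +oo ->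
  law_variance (tilt mu c s) <= v%:E ->
  exists a : R, \int[mu]_x ((x - a%:E) ^+ 2 * tilt_weight c s x) <=
    v%:E * tilt_norm mu c s.
Proof.
move=> N0 Noo; rewrite /law_variance.
set N := tilt_norm mu c s in N0 Noo *.
have Nfin : N \is a fin_num by rewrite ge0_fin_numE// ltW.
have Nr0 : (0 < fine N)%R by rewrite fine_gt0// N0.
have tiltE (f : \bar R -> \bar R) : (forall x, 0 <= f x) ->
    measurable_fun [set: \bar R] f ->
    \int[tilt mu c s]_x f x * N = \int[mu]_x (f x * tilt_weight c s x).
  move=> f0 mf; rewrite integral_mdensity// muleC.
  rewrite -(fineK Nfin) -ge0_integralZl_EFin//.
  - apply: eq_integral => x _; rewrite /tilt_density -/N muleCA; congr (_ * _).
    rewrite muleCA -{2}(fineK Nfin) inver gt_eqF// -EFinM mulfV ?gt_eqF//.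
    by rewrite mule1.
  - by move=> x _; rewrite mule_ge0//; exact: tilt_density_ge0.
  - by apply: emeasurable_funM => //; exact: measurable_tilt_density.
  - exact: ltW.
have tiltT : tilt mu c s setT * N = N.
  rewrite -[tilt mu c s setT]mul1e -integral_cst// tiltE//.
  by rewrite /N/tilt_norm; apply: eq_integral => x _; rewrite mul1e.
have oo_v (f : \bar R -> \bar R) : (forall x, f x = +oo) ->
    \int[tilt mu c s]_x f x <= v%:E -> False.
  move=> foo; rewrite (eq_integral (cst +oo))// integral_cst//.
  rewrite gt0_mulye ?leye_eq// lt0e measure_ge0 andbT; apply/eqP => tilt0.
  by move: N0; rewrite -tiltT tilt0 mul0e ltxx.
case: (law_mean _) => [a| |] le_v.
- exists a; rewrite -tiltE; [|by move=> x; exact: sqre_ge0|exact: measurable_sqrB].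
  by apply: lee_wpmul2r => //; exact: ltW.
(* The difference of two infinities is [-oo], so the distance to an infinite mean has square [+oo]
   at every [x], infinite ones included. *)
- by exfalso; apply: oo_v le_v => x; case: x.
- by exfalso; apply: oo_v le_v => x; case: x.
Qed.

Variable smax : \bar R.
Hypothesis smax0 : 0 < smax.
Hypothesis norm_lty : forall s, tilt_domain smax s -> tilt_norm mu c s < +oo.
Hypothesis var_le : forall s, tilt_domain smax s ->
  law_variance (tilt mu c s) <= v%:E.

Let D0 : tilt_domain smax 0%R. Proof. by split. Qed.

Lemma integrable_tilted_law_sqr :
  exists a : R, mu.-integrable [set: \bar R] (fun x => (x - a%:E) ^+ 2).
Proof.
have [||a] := @tilt_variance_center 0%R _ _ (var_le D0); rewrite ?tilt_norm0 ?ltry//.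
rewrite mule1 => le_v; exists a; apply/integrableP; split.
  exact: measurable_sqrB.
apply: le_lt_trans (ltry v); apply: le_trans le_v.
apply: ge0_le_integral => //.
- apply: measurableT_comp => //.
  exact: measurable_sqrB.
- under eq_fun do rewrite tilt_weight0 mule1.
  exact: measurable_sqrB.
- by move=> x _; rewrite tilt_weight0 mule1 gee0_abs// sqre_ge0.
Qed.

Lemma tilted_law_fin_num : {ae mu, forall x, x \is a fin_num}.
Proof.
have [a /(integrable_ae measurableT) h] := integrable_tilted_law_sqr.
by apply: filterS h => -[x| |] /(_ I).
Qed.

Lemma integrable_tilted_law : mu.-integrable [set: \bar R] (fun x => x).
Proof.
have [a h] := integrable_tilted_law_sqr.
have h1 : mu.-integrable [set: \bar R]
    (fun x => (x - a%:E) ^+ 2 + (1 + `|a|)%:E).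
  apply: integrableD => //; apply/integrableP; split; first exact: measurable_cst.
  by rewrite (eq_integral (cst `|(1 + `|a|)%:E|))// integral_cst// mu1 mule1 ltry.
apply: (le_integrable _ _ _ h1) => // x _.
case: x => [x| |] //; rewrite -EFinB -EFin_expe -EFinD lee_fin.
rewrite [leRHS]ger0_norm; last by rewrite addr_ge0 ?sqr_ge0// addr_ge0.
have h2 := ler_normD (x - a)%R a; rewrite subrK in h2; apply: (le_trans h2).
rewrite -(real_normK (num_real (x - a)%R)).
have := normr_ge0 (x - a)%R; set u := `|(x - a)%R|%R; nra.
Qed.

(** The weight is positive at finite points, which carry the law. If its integral were 0 it would
    vanish almost everywhere, against total mass 1. *)
Lemma tilt_norm_gt0 s : 0 < tilt_norm mu c s.
Proof.
rewrite lt0e integral_ge0 ?andbT; last by move=> x _; exact: tilt_weight_ge0.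
apply/eqP => N0.
have /ae_eq_integral_abs : \int[mu]_x `|tilt_weight c s x| = 0.
  by rewrite -N0; apply: eq_integral => x _; rewrite gee0_abs// tilt_weight_ge0.
move=> /(_ measurableT (measurable_tilt_weight s)) w0.
have : {ae mu, forall x : \bar R, False}.
  apply: filterS2 w0 tilted_law_fin_num => -[x| |] //= /(_ I).
  by rewrite /tilt_weight -EFinB -EFinM -EFinN/= => -[] /eqP; rewrite expR_eq0.
move=> [A [mA A0 subA]]; have : mu setT <= mu A.
  by apply: le_measure; rewrite ?inE//; apply: subset_trans subA => x _ /=; tauto.
by rewrite A0 mu1 lee_fin ler10.
Qed.

Hypothesis mean_ge : c%:E <= law_mean mu.

(** Transfers [mgf_le_of_tilted_variance] to the extended line: [Y] is real-valued and equals
    [x - c] almost everywhere. *)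
Lemma tilt_norm_le s : tilt_domain smax s ->
  tilt_norm mu c s <= (expR (v * s ^+ 2 / 2))%:E.
Proof.
pose Y (x : \bar R) : R := (fine x - c)%R.
have mY : measurable_fun [set: \bar R] Y.
  by apply: measurable_funB => //; exact: measurable_fine.
have mwY (t : R) : measurable_fun [set: \bar R] (fun x => (expR (- (t * Y x)))%:E).
  apply/measurable_EFinP; apply: measurableT_comp => //.
  by apply: measurableT_comp => //; exact: measurable_funM.
have normE t : \int[mu]_x (expR (- (t * Y x)))%:E = tilt_norm mu c t.
  apply: ge0_ae_eq_integral => //.
  - exact: measurable_tilt_weight.
  - by move=> x _; exact: tilt_weight_ge0.
  - by apply: filterS tilted_law_fin_num => -[x| |].
move=> sD; rewrite -normE.
apply: (@mgf_le_of_tilted_variance _ _ _ mu Y smax) => //.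
- by move=> t tD; rewrite normE norm_lty.
- move=> t tD.
  have [a] := tilt_variance_center (tilt_norm_gt0 t) (norm_lty tD) (var_le tD).
  (* Passing from [x] to [Y] shifts the law by [c], so the center shifts too. *)
  move=> le_v; exists (a - c)%R; rewrite normE; apply: le_trans le_v.
  rewrite le_eqVlt; apply/orP; left; apply/eqP.
  apply: ge0_ae_eq_integral => //.
  + apply/measurable_EFinP; apply: measurable_funM;
      last by have /measurable_EFinP := mwY t.
    by apply: measurable_funX; exact: measurable_funB.
  + apply: emeasurable_funM; last exact: measurable_tilt_weight.
    exact: measurable_sqrB.
  + by move=> x _; rewrite lee_fin mulr_ge0 ?sqr_ge0 ?expR_ge0.
  + by move=> x _; rewrite mule_ge0 ?sqre_ge0 ?tilt_weight_ge0.
  + apply: filterS tilted_law_fin_num => -[x| |] //= _ _.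
    have -> : tilt_weight c t x%:E = (expR (- (t * (x - c))))%:E by [].
    by rewrite -EFinM /Y/=; congr (_%:E); ring.
- have ic : mu.-integrable [set: \bar R] (cst c%:E).
    apply/integrableP; split; first exact: measurable_cst.
    by rewrite (eq_integral (cst `|c%:E|))// integral_cst// mu1 mule1 ltry.
  apply: fine_ge0.
  rewrite [leRHS](_ : _ = \int[mu]_x (x - c%:E)); last first.
    apply: ae_eq_integral => //.
    + exact/measurable_EFinP.
    + exact: emeasurable_funB.
    + by apply: filterS tilted_law_fin_num => -[x| |].
  rewrite integralB// ?integral_cst// ?mu1 ?mule1 ?sube_ge0//.
  exact: integrable_tilted_law.
Qed.
End tilted_law.

Lemma measurable_lne (R : realType) : measurable_fun [set: \bar R] (@lne R).
Proof.
rewrite [X in measurable_fun _ X](_ : _ = fun x : \bar R =>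
    if x == +oo then +oo else if x <= 0 then -oo else (ln (fine x))%:E).
  apply: measurable_fun_ifT => //; first exact: measurable_fun_eqe.
  apply: measurable_fun_ifT => //.
    exact: measurable_fun_lee.
  apply/measurable_EFinP; apply: measurableT_comp => //; exact: fine_measurable.
by apply/funext => -[x| |] //=; rewrite leNye.
Qed.

(** Isolates the factor depending on [c], which becomes a random variable below, from a fixed
    function of [x] to which a conditional law applies. *)
Lemma tilt_weight_factor (R : realType) (c s : R) (x : \bar R) : (0 <= s)%R ->
  tilt_weight c s x = (expR (s * c))%:E * expeR (- (s%:E * x)).
Proof.
rewrite /tilt_weight le_eqVlt => /predU1P[<-|s0].
  by rewrite !mul0e oppe0 mul0r expeR0 expR0 mule1.
case: x => [x| |] /=.
- by rewrite -EFinM -expRD; congr (expR _)%:E; ring.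
- by rewrite gt0_muley ?lte_fin//= mule0.
- by rewrite gt0_muleNy ?lte_fin//= gt0_muley// lte_fin expR_gt0.
Qed.

(** This carries finiteness of the normaliser from a tilt [r] down to all smaller ones. *)
Lemma tilt_weight_le (R : realType) (c s r : R) (x : \bar R) : (0 <= s <= r)%R ->
  tilt_weight c s x <= 1 + tilt_weight c r x.
Proof.
move=> /andP[s0 sr]; have r0 := le_trans s0 sr.
rewrite !tilt_weight_factor//; case: x => [x| |].
- rewrite /= -!EFinM -EFinD lee_fin -!expRD.
  have := @expRN_le_add _ 0%R r s (x - c); rewrite s0 sr mul0r oppr0 expR0 => /(_ isT).
  have e t : (t * c + - (t * x) = - (t * (x - c)))%R by ring.
  by rewrite !e.
- move: s0; rewrite le_eqVlt => /predU1P[<-|s0].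
    rewrite mul0r mul0e oppe0 expeR0 expR0 mule1 leeDl//.
    by rewrite mule_ge0 ?lee_fin ?expR_ge0 ?expeR_ge0.
  rewrite gt0_muley ?lte_fin//= mule0 adde_ge0// mule_ge0 ?lee_fin ?expR_ge0//.
  exact: expeR_ge0.
- move: s0; rewrite le_eqVlt => /predU1P[<-|s0].
    rewrite mul0r mul0e oppe0 expeR0 expR0 mule1 leeDl//.
    by rewrite mule_ge0 ?lee_fin ?expR_ge0 ?expeR_ge0.
  have {}r0 := lt_le_trans s0 sr.
  by rewrite !gt0_muleNy ?lte_fin//= !gt0_muley ?lte_fin ?expR_gt0 ?leey.
Qed.

(** * Kernel versions of the conditional mean and of the normaliser *)

Section conditional_tilt.
Context (d : measure_display) (T : measurableType d) (R : realType)
  (P : probability T R) (G : set (set T)).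
Hypotheses (sG : sigma_algebra setT G) (GT : G `<=` measurable).
Variables (X : T -> \bar R) (k : R.-pker (g_sigma_algebraType G) ~> \bar R).
Hypothesis mX : measurable_fun [set: T] X.
Hypothesis Xk : is_regular_cond_dist P X k.

Lemma is_cexp_kernel (phi : \bar R -> \bar R) :
  (forall x, 0 <= phi x) -> measurable_fun [set: \bar R] phi ->
  is_cexp P G (phi \o X) (fun w => \int[k w]_x phi x).
Proof.
move=> phi0 mphi; split.
- apply: (measurable_fun_integral_kernel (l := k)) => //.
  by move=> U mU; exact: measurable_kernel.
- by move=> w; exact: integral_ge0.
- by move=> A GA; exact: (integral_cond_dist sG GT).
Qed.

(** Positive and negative parts are treated separately, since [cexp] and the integral are both
    differences of these, with the same convention for [+oo - +oo]. *)
Lemma cexp_law_mean :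
  {ae P, forall w, cexp P G X w = law_mean (k w)}.
Proof.
have mpos : measurable_fun [set: \bar R] (fun x : \bar R => maxe x 0).
  exact: measurable_maxe.
have mneg : measurable_fun [set: \bar R] (fun x : \bar R => maxe (- x) 0).
  by apply: measurable_maxe => //; exact: measurableT_comp.
have pos : is_cexp P G X^\+ (fun w => \int[k w]_x maxe x 0).
  have -> : X^\+ = (fun x => maxe x 0) \o X.
    by apply/funext => w; rewrite funeposE.
  by apply: (@is_cexp_kernel (fun x => maxe x 0)) => // x; rewrite le_max lexx orbT.
have neg : is_cexp P G X^\- (fun w => \int[k w]_x maxe (- x) 0).
  have -> : X^\- = (fun x => maxe (- x) 0) \o X.
    by apply/funext => w; rewrite funenegE.
  by apply: (@is_cexp_kernel (fun x => maxe (- x) 0)) => // x; rewrite le_max lexx orbT.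
apply: filterS2 (cexp_ge0_ae sG GT pos) (cexp_ge0_ae sG GT neg) => w pE nE.
rewrite /cexp pE nE /law_mean [RHS]integralE.
by congr (_ - _); apply: eq_integral => x _; rewrite ?funeposE ?funenegE.
Qed.

Variables (c : T -> R) (s : R).
Hypothesis mc : measurable_wrt G c.
Hypothesis s0 : (0 <= s)%R.

Lemma is_cexp_tilt_norm :
  is_cexp P G (fun w => tilt_weight (c w) s (X w))
    (fun w => tilt_norm (k w) (c w) s).
Proof.
pose Z w := (expR (s * c w))%:E; pose phi (x : \bar R) := expeR (- (s%:E * x)).
have phi0 x : 0 <= phi x by exact: expeR_ge0.
have mphi : measurable_fun [set: \bar R] phi.
  apply: (measurableT_comp (@measurable_expeR R)).
  by apply: measurableT_comp => //; exact: measurable_funeM.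
have Z0 w : 0 <= Z w by rewrite lee_fin expR_ge0.
have mZ : measurable_wrt G Z.
  apply/measurable_EFinP; apply: measurableT_comp => //.
  by apply: measurable_funM => //; exact: measurable_cst.
have [mI I0 IE] := is_cexp_kernel phi0 mphi.
have -> : (fun w => tilt_norm (k w) (c w) s) = (fun w => Z w * \int[k w]_x phi x).
  apply/funext => w; rewrite /tilt_norm -ge0_integralZl_EFin ?expR_ge0//.
  by apply: eq_integral => x _; rewrite tilt_weight_factor.
under [X in is_cexp _ _ X]eq_fun do rewrite tilt_weight_factor//.
split.
- exact: emeasurable_funM.
- by move=> w; rewrite mule_ge0.
move=> A GA; have mA := GT GA.
(* The weight pulled out is [Z] times the indicator of [A], so that the integral over [A] becomes
   one over the whole space. *)
have := @cexp_pull_out _ _ _ P _ sG GT (phi \o X) (fun w => \int[k w]_x phi x)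
  (fun w => (\1_A w)%:E * Z w) (fun w => phi0 _) (measurableT_comp mphi mX) I0
  (measurable_wrtT sG GT mI) IE.
have mAZ : measurable_wrt G (fun w => (\1_A w)%:E * Z w).
  apply: emeasurable_funM => //; apply: measurable_indicE.
  exact/(measurable_g_sigma sG).
move/(_ mAZ (fun w => mule_ge0 (indicE_ge0 _ A w) (Z0 w))).
have E (f : T -> \bar R) : \int[P]_(w in A) (Z w * f w) =
    \int[P]_w ((\1_A w)%:E * Z w * f w).
  rewrite integral_mkcond/=; apply: eq_integral => w _.
  by rewrite patchE indicE -muleA; case: ifP; rewrite ?mul1e ?mul0e.
by rewrite -!E.
Qed.

End conditional_tilt.

(** * Betting with a drift certificate *)

Section certified_betting.
Context (d : measure_display) (T : measurableType d) (R : realType)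
  (F : nat -> set (set T)) (P : probability T R).
Hypothesis HF : is_filtration F.
Variable E : nat -> T -> \bar R.
Hypothesis mE : forall n, (0 < n)%N -> measurable_wrt (F n) (E n).
Hypothesis E0 : forall n, (0 < n)%N -> forall w, 0 <= E n w.
Variable c : nat -> T -> R.
Hypothesis Hc : drift_certificate P F E c.
Variables (smax : \bar R) (v : nat -> R).
Hypothesis Hv : forall n, (0 < n)%N -> (0 <= v n)%R.
Hypothesis Hsmax : 0 < smax.
Hypothesis Hfin : forall (n : nat) (s : R), (0 < n)%N -> tilt_domain smax s ->
  {ae P, forall w : T, cond_log_mgf P F E c n s w \is a fin_num}.
Variable kappa : forall n : nat, R.-pker (g_sigma_algebraType (F n.-1)) ~> \bar R.
Hypothesis Hkappa : forall n : nat, (0 < n)%N ->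
  is_regular_cond_dist P (log_increment E n) (kappa n).
Hypothesis Hvar : {ae P, forall w : T, forall (n : nat) (s : R),
  (0 < n)%N -> tilt_domain smax s ->
  law_variance (tilt (kappa n w) (c n w) s) <= (v n)%:E}.

Let sF n : sigma_algebra setT (F n). Proof. by case: HF. Qed.
Let FT n : F n `<=` measurable. Proof. by case: HF. Qed.

Lemma filtration_measurable_wrt d' (U : measurableType d') (m n : nat) (f : T -> U) :
  (m <= n)%N -> measurable_wrt (F m) f -> measurable_wrt (F n) f.
Proof.
case: HF => _ _ mono _ mn mf _ B mB; apply/(measurable_g_sigma (sF n)).
apply: (mono _ _ mn); apply/(measurable_g_sigma (sF m)).
exact: mf.
Qed.

Lemma measurable_log_increment n : (0 < n)%N ->
  measurable_wrt (F n) (log_increment E n).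
Proof. by move=> n0; apply: (measurableT_comp (@measurable_lne R)); exact: mE. Qed.

Let mL n : (0 < n)%N -> measurable_fun [set: T] (log_increment E n).
Proof.
move=> n0.
exact: (measurable_wrtT (sF n) (@FT n) (measurable_log_increment n0)).
Qed.

Let wgt (s : R) n w := tilt_weight (c n w) s (log_increment E n w).

Let cexp_wgt n (s : R) : (0 < n)%N -> (0 <= s)%R ->
  is_cexp P (F n.-1) (wgt s n) (fun w => tilt_norm (kappa n w) (c n w) s).
Proof.
move=> n0 s0; have [mc _] := Hc n0.
exact: (is_cexp_tilt_norm (sF n.-1) (@FT n.-1) (mL n0) (Hkappa n0) mc s0).
Qed.

Let cond_log_mgfE n (s : R) : (0 < n)%N -> (0 <= s)%R ->
  {ae P, forall w : T, cond_log_mgf P F E c n s w =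
    lne (tilt_norm (kappa n w) (c n w) s)}.
Proof.
move=> n0 s0.
have wgt0 w : 0 <= wgt s n w by exact: tilt_weight_ge0.
have := cexp_ae (sF n.-1) (@FT n.-1) wgt0 (cexp_wgt n0 s0).
by apply: filterS => w; rewrite /cond_log_mgf => <-.
Qed.

(** [Hfin] has an exceptional null set for each [s]. Rational tilts need countably many of these,
    and [tilt_weight_le] extends finiteness to every [s] below a rational tilt in the domain. *)
Lemma ae_tilt_norm_lty n : (0 < n)%N -> {ae P, forall w : T, forall s,
  tilt_domain smax s -> tilt_norm (kappa n w) (c n w) s < +oo}.
Proof.
move=> n0.
pose Q m (w : T) := if unpickle m is Some q then
  tilt_domain smax (ratr q : R) -> tilt_norm (kappa n w) (c n w) (ratr q) < +oo
  else True.
have : {ae P, forall w : T, forall m, Q m w}.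
  apply: ae_foralln => m; rewrite /Q; case: unpickle => [q|]; last exact: aeW.
  have [qD|qD] := pselect (tilt_domain smax (ratr q : R)); last exact: aeW.
  have [q0 _] := qD.
  apply: filterS2 (cond_log_mgfE n0 q0) (Hfin n0 qD) => w -> fin _.
  by move: fin; case: tilt_norm => //= r _; rewrite ltry.
move=> QP; apply: filterS QP => w Qw s [s0 sm].
have [r [sr rD]] : exists r : rat, (s <= ratr r)%R /\ tilt_domain smax (ratr r : R).
  have [b sb bm] : exists2 b, (s < b)%R & b%:E <= smax.
    case: smax sm => [b| |] //; first by exists b => //; rewrite lte_fin in sm *.
    by move=> _; exists (s + 1)%R; rewrite ?ltrDl ?leey.
  have [r] := rat_in_itvoo sb; rewrite in_itv/= => /andP[sr rb].
  exists r; split; first exact: ltW.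
  by split; [exact: (le_trans s0 (ltW sr))|apply: lt_le_trans bm; rewrite lte_fin].
have := Qw (pickle r); rewrite /Q pickleK => /(_ rD) Nr.
apply: (@le_lt_trans _ _ (\int[kappa n w]_x (1 + tilt_weight (c n w) (ratr r) x))).
  apply: ge0_le_integral => //.
  - by move=> x _; exact: tilt_weight_ge0.
  - exact: measurable_tilt_weight.
  - by apply: emeasurable_funD => //; exact: measurable_tilt_weight.
  - by move=> x _; apply: tilt_weight_le; rewrite s0.
rewrite ge0_integralD//.
- by rewrite integral_cst// prob_kernel mule1 lte_add_pinfty// ltry.
- by move=> x _; exact: tilt_weight_ge0.
- exact: measurable_tilt_weight.
Qed.

(** For almost every [w] the law [kappa n w] satisfies the assumptions of [tilt_norm_le]; the drift
    certificate becomes the bound on its mean. *)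
Lemma ae_tilt_norm_le n : (0 < n)%N -> {ae P, forall w : T,
  (forall s, tilt_domain smax s ->
    tilt_norm (kappa n w) (c n w) s <= (expR (v n * s ^+ 2 / 2))%:E) /\
  {ae kappa n w, forall x, x \is a fin_num}}.
Proof.
move=> n0; have [_ drift] := Hc n0.
have mean := cexp_law_mean (sF n.-1) (@FT n.-1) (mL n0) (Hkappa n0).
have lty := ae_tilt_norm_lty n0.
have dm : {ae P, forall w : T, (c n w)%:E <= law_mean (kappa n w)}.
  by apply: filterS2 mean drift => w ->.
apply: filterS3 dm lty Hvar => w mw lw vw.
have k1 : kappa n w [set: \bar R] = 1 by exact: prob_kernel.
split.
  apply: (tilt_norm_le k1 Hsmax lw) => //.
  by move=> s sD; exact: vw.
by apply: (tilted_law_fin_num k1 Hsmax (c := c n w) (v := v n)) => s sD; exact: vw.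
Qed.

Lemma ae_log_increment_fin_num n : (0 < n)%N ->
  {ae P, forall w : T, log_increment E n w \is a fin_num}.
Proof.
move=> n0; pose B := ~` [set x : \bar R | x \is a fin_num].
have mB : measurable B.
  apply: measurableC; rewrite -[X in measurable X]setTI.
  exact: (emeasurable_fin_num measurableT (@measurable_id _ _ _)).
have XB : P (log_increment E n @^-1` B) = 0.
  rewrite -[X in P X]setTI (Hkappa n0)//; last first.
    by apply/(measurable_g_sigma (sF n.-1)).
  rewrite (ae_eq_integral (cst 0)) ?integral0//.
  - apply: (measurable_wrtT (sF n.-1) (@FT n.-1)).
    exact: measurable_kernel.
  - apply: filterS (ae_tilt_norm_le n0) => w [_ kfin] _ /=.
    by apply: measure_negligible.
exists (log_increment E n @^-1` B); split => //.
by rewrite -[X in measurable X]setTI; exact: mL.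
Qed.

Lemma is_majorant_sqr :
  is_majorant P F E c smax (fun n s _ => (v n * s ^+ 2 / 2)%:E).
Proof.
move=> n n0; split; first by move=> w; rewrite expr0n/= mulr0 mul0r.
move=> s sD; have [s0 _] := sD; split.
- exact: measurable_cst.
- by move=> w; rewrite lee_fin divr_ge0// mulr_ge0 ?Hv// sqr_ge0.
- apply: filterS2 (cond_log_mgfE n0 s0) (ae_tilt_norm_le n0) => w -> [/(_ _ sD) Nle _].
  rewrite -(expeRK (v n * s ^+ 2 / 2)%:E) lee_lne// in_itv/= leey andbT ?expeR_ge0//.
  by apply: integral_ge0 => x _; exact: tilt_weight_ge0.
Qed.

Let Z s t w := \prod_(1 <= n < t.+1) wgt s n w.

Let Z_ge0 s t w : 0 <= Z s t w.
Proof. by rewrite /Z; apply: prode_ge0 => n _; exact: tilt_weight_ge0. Qed.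

Let ZS s t w : Z s t.+1 w = Z s t w * wgt s t.+1 w.
Proof. by rewrite /Z big_nat_recr. Qed.

Let mwgt s n : (0 < n)%N -> measurable_wrt (F n) (wgt s n).
Proof.
move=> n0; have [mc _] := Hc n0.
have {}mc : measurable_wrt (F n) (c n).
  by apply: filtration_measurable_wrt mc; exact: leq_pred.
apply: (measurableT_comp (@measurable_expeR R)).
apply: measurableT_comp => //; apply: measurable_funeM.
apply: emeasurable_funB; first exact: measurable_log_increment.
exact/measurable_EFinP.
Qed.

Let mZ s t : measurable_wrt (F t) (Z s t).
Proof.
elim: t => [|t IH].
  have -> : Z s 0 = cst 1 by apply/funext => w; rewrite /Z big_nil.
  exact: measurable_cst.
have -> : Z s t.+1 = (fun w => Z s t w * wgt s t.+1 w) by apply/funext => w; rewrite ZS.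
apply: emeasurable_funM; last exact: mwgt.
exact: filtration_measurable_wrt IH.
Qed.

(** By induction on [t]: given [F t], the last weight has conditional expectation at most
    [expR (v t.+1 * s ^+ 2 / 2)], and the earlier product is [F t]-measurable. *)
Lemma prod_tilt_weight_le s t : tilt_domain smax s ->
  \int[P]_w \prod_(1 <= n < t.+1) tilt_weight (c n w) s (log_increment E n w) <=
  (expR ((\sum_(1 <= n < t.+1) v n) * s ^+ 2 / 2))%:E.
Proof.
move=> sD; have [s0 _] := sD.
suff : \int[P]_w Z s t w <=
  (expR ((\sum_(1 <= n < t.+1) v n) * s ^+ 2 / 2))%:E by [].
elim: t => [|t IH].
  under eq_integral do rewrite /Z big_nil.
  rewrite integral_cst// mul1e big_nil !mul0r expR0.
  exact: probability_le1.
under eq_integral do rewrite ZS.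
have [mN N0 NE] := cexp_wgt (ltn0Sn t) s0.
(* Replaces the last weight by its conditional expectation, the normaliser. *)
rewrite -(cexp_pull_out (sF t) (@FT t) (X := wgt s t.+1) _ _ N0 _ NE
  (@mZ s t))//; last 3 first.
- by move=> w; exact: tilt_weight_ge0.
- exact: (measurable_wrtT (sF t.+1) (@FT t.+1) (@mwgt s t.+1 (ltn0Sn t))).
- exact: (measurable_wrtT (sF t) (@FT t) mN).
have mZt := measurable_wrtT (sF t) (@FT t) (@mZ s t).
have mNt := measurable_wrtT (sF t) (@FT t) mN.
apply: (@le_trans _ _ (\int[P]_w (Z s t w * (expR (v t.+1 * s ^+ 2 / 2))%:E))).
  apply: ae_ge0_le_integral => //.
  - by move=> w _; rewrite mule_ge0.
  - exact: emeasurable_funM.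
  - by move=> w _; rewrite mule_ge0// lee_fin expR_ge0.
  - by apply: emeasurable_funM => //; exact: measurable_cst.
  - apply: filterS (ae_tilt_norm_le (ltn0Sn t)) => w [/(_ _ sD) Nle _] _.
    exact: lee_wpmul2l.
rewrite ge0_integralZr//.
rewrite big_nat_recr//= !mulrDl expRD EFinM.
by apply: lee_wpmul2r => //; rewrite lee_fin expR_ge0.
Qed.

(** A finite logarithm forces each [E n w] to be positive and finite, where [expR] inverts [ln]. *)
Lemma wealthE (w : T) t :
  (forall n, (0 < n)%N -> log_increment E n w \is a fin_num) ->
  wealth E t w = (expR (\sum_(1 <= n < t.+1) fine (log_increment E n w)))%:E.
Proof.
move=> Lfin; elim: t => [|t IH]; first by rewrite /wealth !big_nil expR0.
have := IH; rewrite /wealth !(big_nat_recr t.+1)//= => ->.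
rewrite expRD EFinM; congr (_ * _).
have := Lfin t.+1 isT; rewrite /log_increment.
have := E0 (ltn0Sn t) w; case: (E t.+1 w) => [x| |] //= x0.
by case: ifPn => //; rewrite -ltNge => {}x0 _ /=; rewrite lnK.
Qed.

Lemma prod_tilt_weightE (w : T) s t :
  (forall n, (0 < n)%N -> log_increment E n w \is a fin_num) ->
  \prod_(1 <= n < t.+1) tilt_weight (c n w) s (log_increment E n w) =
  (expR (- (s * (\sum_(1 <= n < t.+1) fine (log_increment E n w) -
                 \sum_(1 <= n < t.+1) c n w))))%:E.
Proof.
move=> Lfin; elim: t => [|t IH]; first by rewrite !big_nil subr0 mulr0 oppr0 expR0.
rewrite !(big_nat_recr t.+1)//= IH.
have -> : tilt_weight (c t.+1 w) s (log_increment E t.+1 w) =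
    (expR (- (s * (fine (log_increment E t.+1 w) - c t.+1 w))))%:E.
  by rewrite -[in LHS](fineK (Lfin t.+1 isT)).
by rewrite -EFinM -expRD; congr (expR _)%:E; ring.
Qed.

Let measurable_wealth t : measurable_fun [set: T] (wealth E t).
Proof.
elim: t => [|t IH]; rewrite /wealth.
  by under eq_fun do rewrite big_nil; exact: measurable_cst.
under eq_fun do rewrite big_nat_recr//=.
apply: emeasurable_funM => //.
exact: (measurable_wrtT (sF t.+1) (@FT t.+1) (mE (ltn0Sn t))).
Qed.

Let measurable_wealth_le t (a : R) : measurable [set w | wealth E t w <= a%:E].
Proof.
rewrite -[X in measurable X]setTI.
exact: (emeasurable_fun_infty_c measurableT (measurable_wealth t)).
Qed.

Lemma miss_prob_le1 (alpha : R) (t : nat) : miss_prob P E alpha t <= 1.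
Proof. by apply: probability_le1; exact: measurable_wealth_le. Qed.

(** Markov's inequality for the product of weights. On the event, the increments sum to at most
    [ln alpha^-1] and the drifts to at least [C], so the product is at least [expR (s * D)]. *)
Lemma miss_prob_chernoff (C V alpha s : R) (t : nat) : (0 < alpha)%R ->
  {ae P, forall w : T, (C <= \sum_(1 <= n < t.+1) c n w)%R} ->
  (\sum_(1 <= n < t.+1) v n <= V)%R -> tilt_domain smax s ->
  miss_prob P E alpha t <=
  (expR (- (s * (C - ln alpha^-1) - V * s ^+ 2 / 2)))%:E.
Proof.
move=> alpha0 HC HV sD; have [s0 _] := sD.
rewrite /miss_prob; set A := [set w | _]; set D := (C - ln alpha^-1)%R.
have mA : measurable A by exact: measurable_wealth_le.
rewrite opprB expRD expRN EFinM.
rewrite lee_pdivlMr ?expR_gt0// muleC -integral_cst//.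
apply: (@le_trans _ _ (\int[P]_(w in A) Z s t w)).
  apply: ae_ge0_le_integral => //.
  - by move=> w _; rewrite lee_fin expR_ge0.
  - exact/measurable_funTS/(measurable_wrtT (sF t) (@FT t)).
  - have Lfin : {ae P, forall w : T, forall n, (0 < n)%N ->
        log_increment E n w \is a fin_num}.
      apply: ae_foralln => -[|n]; first exact: aeW.
      by apply: filterS (ae_log_increment_fin_num (ltn0Sn n)) => w.
    apply: filterS2 Lfin HC => w Lfin HCw Aw.
    rewrite /Z prod_tilt_weightE// lee_fin ler_expR.
    move: Aw; rewrite /A/= wealthE// lee_fin => Ww.
    have : (\sum_(1 <= n < t.+1) fine (log_increment E n w) <= ln alpha^-1)%R.
      by rewrite -(@expRK R (\sum_(_ <= _ < _) _)%R) ler_ln ?posrE ?expR_gt0 ?invr_gt0.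
    rewrite -mulrN => Sw; apply: ler_wpM2l => //.
    by rewrite /D; lra.
apply: (@le_trans _ _ (\int[P]_w Z s t w)).
  by apply: ge0_subset_integral => //; exact: (measurable_wrtT (sF t) (@FT t)).
apply: (le_trans (prod_tilt_weight_le t sD)).
rewrite lee_fin ler_expR ler_pM2r//; apply: ler_wpM2r => //; exact: sqr_ge0.
Qed.

Lemma seq_miss_prob_le alpha t : (0 < t)%N ->
  seq_miss_prob P E alpha t <= miss_prob P E alpha t.
Proof.
move=> t0.
have subA n : (0 < n)%N -> (n <= t)%N ->
    [set w | t%:R%:E < crossing_time E alpha w] `<=`
    [set w | wealth E n w <= (alpha^-1)%:E].
  move=> n0 nt w /= Aw; rewrite leNgt; apply/negP => Wn.
  move: Aw; rewrite ltNge => /negP; apply; apply: (@le_trans _ _ n%:R%:E).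
    by apply: ereal_inf_lbound; exists n.
  by rewrite lee_fin ler_nat.
apply: le_measure; rewrite ?inE; [|exact: measurable_wealth_le|exact: subA].
(* Monotonicity of [P] also needs the smaller event to be measurable; it is a finite intersection of
   wealth events. *)
rewrite [X in measurable X](_ : _ =
  \bigcap_(n in [set n | (0 < n <= t)%N]) [set w | wealth E n w <= (alpha^-1)%:E]).
  apply: bigcap_measurable => [|n _]; first by exists t; rewrite /= t0 leqnn.
  exact: measurable_wealth_le.
apply/seteqP; split=> [w Aw n /andP[n0 nt]|w Aw /=]; first exact: (subA n).
(* Crossing times are integers, so without a crossing up to [t] the infimum is at least [t.+1]. *)
apply: (@lt_le_trans _ _ t.+1%:R%:E); first by rewrite lte_fin ltr_nat.
apply: le_ereal_inf_tmp => _ [n [n0 Wn] <-]; rewrite lee_fin ler_nat ltnNge.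
apply/negP => nt; move: Wn; rewrite ltNge; apply/negP; rewrite negbK.
by apply: (Aw n); rewrite /= n0.
Qed.

End certified_betting.

(** * The majorant, the rate function and the error bound combined *)

Unset Implicit Arguments.
Set Strict Implicit.
Set Printing Implicit Defensive.

Theorem corollary4p25 (d : measure_display) (Omega : measurableType d)
    (R : realType) (F : nat -> set (set Omega))
    (P0 P1 : probability Omega R)
    (HF : is_filtration F)
    (Hdom : forall t : nat, dominated_on (F t) P1 P0)
    (E : nat -> Omega -> \bar R) (HE : betting_sequence P0 F E)
    (c : nat -> Omega -> R) (Hc : drift_certificate P1 F E c)
    (C : nat -> R)
    (HC : forall t : nat, (0 < t)%N ->
      {ae P1, forall w, (C t <= \sum_(1 <= n < t.+1) c n w)%R})
    (smax : \bar R) (Hsmax : 0 < smax)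
    (v : nat -> R) (Hv : forall n : nat, (0 < n)%N -> (0 <= v n)%R)
    (Hfin : forall (n : nat) (s : R), (0 < n)%N -> tilt_domain smax s ->
      {ae P1, forall w, cond_log_mgf P1 F E c n s w \is a fin_num})
    (kappa : forall n : nat, R.-pker (g_sigma_algebraType (F n.-1)) ~> \bar R)
    (Hkappa : forall n : nat, (0 < n)%N ->
      is_regular_cond_dist P1 (log_increment E n) (kappa n))
    (Hvar : {ae P1, forall w, forall (n : nat) (s : R),
      (0 < n)%N -> tilt_domain smax s ->
      law_variance (tilt (kappa n w) (c n w) s) <= (v n)%:E})
    (V : nat -> R)
    (HV : forall t : nat, (0 < t)%N ->
      (\sum_(1 <= n < t.+1) v n <= V t)%R) :
  let psi := fun (n : nat) (s : R) (_ : Omega) => (v n * s ^+ 2 / 2)%:E in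
  let Psi := fun (t : nat) (s : R) => (V t * s ^+ 2 / 2)%:E in
  [/\ is_majorant P1 F E c smax psi,
      is_aggregate P1 c smax psi C Psi,
      forall (t : nat) (x : R), (0 < t)%N -> (0 <= x)%R ->
        (x%:E <= smax * (V t)%:E ->
          rate_function smax (Psi t) x = (x ^+ 2)%:E / (2 * V t)%:E) /\
        (smax * (V t)%:E < x%:E ->
          rate_function smax (Psi t) x =
            smax * x%:E - (V t)%:E * smax ^+ 2 / 2%:E)
    & forall (alpha : R) (t : nat), (0 < alpha < 1)%R -> (0 < t)%N ->
        let Delta := excess_drift (C t) alpha in
        let sstar := optimal_tilt smax (V t) Delta in
        [/\ sup_approached_at smax (Psi t) Delta sstar,
            (0 < Delta)%R \/ (0 < V t)%R -> forall s : \bar R,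
              sup_approached_at smax (Psi t) Delta s -> s = sstar,
            Delta%:E <= smax * (V t)%:E -> sstar < smax ->
              sup_attained_at smax (Psi t) Delta sstar,
            smax * (V t)%:E < Delta%:E -> forall s : \bar R,
              ~ sup_attained_at smax (Psi t) Delta s
          & seq_miss_prob P1 E alpha t <= miss_prob P1 E alpha t /\
            miss_prob P1 E alpha t <=
              expeR (- ((Delta / 2)%:E * mine (Delta%:E / (V t)%:E) smax))]].
Proof.
move=> psi Psi.
have mE n : (0 < n)%N -> measurable_wrt (F n) (E n) by move/HE => [].
have E0 n : (0 < n)%N -> forall w, 0 <= E n w by move/HE => [].
have V0 t : (0 < t)%N -> (0 <= V t)%R.
  move=> t0; apply: le_trans (HV t t0); rewrite big_nat_cond sumr_ge0// => n.
  by rewrite andbT => /andP[n0 _]; exact: Hv.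
split.
- exact: (is_majorant_sqr HF mE Hc Hv Hsmax Hfin Hkappa Hvar).
- move=> t t0; split; first exact: HC.
  move=> s _; apply: aeW => w; rewrite sumEFin lee_fin -mulr_suml -mulr_suml.
  by rewrite ler_pM2r// ler_wpM2r ?sqr_ge0// HV.
- move=> t x t0 x0; split; first exact: (rate_function_le Hsmax (V0 t t0) x0).
  exact: (rate_function_gt Hsmax (V0 t t0) x0).
move=> alpha t /andP[alpha0 alpha1] t0 Delta sstar.
have Delta0 : (0 <= Delta)%R by rewrite /Delta /excess_drift le_max lexx orbT.
split.
- exact: (sup_approached_optimal_tilt Hsmax (V0 t t0) Delta0).
- by move=> DV s; exact: (sup_approached_unique Hsmax (V0 t t0) Delta0 DV).
- exact: (sup_attained_optimal_tilt Hsmax (V0 t t0) Delta0).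
- by move=> lt_D s; exact: (sup_not_attained Hsmax (V0 t t0) Delta0 lt_D).
split; first exact: (seq_miss_prob_le P1 HF mE alpha t0).
set p := miss_prob P1 E alpha t; have p0 : 0 <= p by exact: measure_ge0.
(* Taking the supremum over all tilts, instead of inserting an optimal one, copes with a supremum
   that is not attained; the extended logarithm allows [p = 0]. *)
have lnp : rate_function smax (Psi t) Delta <= - lne p.
  apply: ge_ereal_sup => _ [s sD <-].
  rewrite leeNr -(expeRK (- rate_objective (Psi t) Delta s)) lee_lne;
    [|by rewrite in_itv/= p0 leey|by rewrite in_itv/= leey andbT lee_fin expR_ge0].
  have [D_pos|D_neg] := leP 0%R (C t - ln alpha^-1)%R.
    rewrite /Delta /excess_drift max_l//.
    exact: (miss_prob_chernoff HF mE E0 Hc Hsmax Hfin Hkappa Hvar alpha0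
      (HC t t0) (HV t t0) sD).
  (* Here [C t < ln alpha^-1], so [Delta = 0] and the objective is nonpositive: the trivial bound
     [p <= 1] suffices. *)
  apply: (@le_trans _ _ 1); first exact: (miss_prob_le1 P1 HF mE).
  have D_0 : Delta = 0%R by rewrite /Delta /excess_drift max_r// ltW.
  rewrite D_0 lee_fin -expR0 ler_expR mulr0 sub0r opprK.
  by rewrite divr_ge0// mulr_ge0 ?V0// sqr_ge0.
have half := le_trans (half_optimal_tilt_le Hsmax (V0 t t0) Delta0) lnp.
rewrite -(lneK (x := p)) ?in_itv/= ?p0 ?leey// lee_expeR leeNr.
exact: half.
Qed.
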